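(* In the setting described in the context, for any vector $\boldsymbol{c}=(c_1,c_2)$ of positive integers, for every $x_1,x_2\in\mathbb{Z}_+$ with $x_1=0$ or $x_2=0$, for every $l_1,l_2\in\mathbb{Z}_+$ with $l_1=0$ or $l_2=0$, and for every $j,j'\in S_0$, $$\lim_{k\to\infty}\frac1k\log\tilde q_{(x_1,x_2,j),(c_1k+l_1,c_2k+l_2,j')}=-\sup_{\boldsymbol\theta\in\Gamma}\langle\boldsymbol{c},\boldsymbol\theta\rangle .$$
   Context: Let $S_0=\{1,\dots,s_0\}$ be finite and $\{\boldsymbol{Y}_n\}$ a Markov chain on $\mathbb{S}=\mathbb{Z}^2\times S_0$ with $\mathbb{P}(\boldsymbol{Y}_{n+1}=(x_1+k,x_2+l,j')\mid\boldsymbol{Y}_n=(x_1,x_2,j))=[A_{k,l}]_{j,j'}$ for $k,l\in\{-1,0,1\}$ (no other transitions), $A_{k,l}$ nonnegative $s_0\times s_0$ with $\sum A_{k,l}$ stochastic. Let $\mathbb{S}_+=\mathbb{Z}_+^2\times S_0$, $P_+$ the restriction of the transition matrix to $\mathbb{S}_+$, $\tau=\inf\{n\ge0:\boldsymbol{Y}_n\notin\mathbb{S}_+\}$, $\tilde q_{\boldsymbol{y},\boldsymbol{y}'}=\mathbb{E}\big(\sum_{n=0}^{\tau-1}1(\boldsymbol{Y}_n=\boldsymbol{y}')\mid\boldsymbol{Y}_0=\boldsymbol{y}\big)$ (expected number of visits to $\boldsymbol y'$ before leaving $\mathbb{S}_+$). With $\boldsymbol\pi_{*,*}$ the stationary distribution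 of $\sum A_{k,l}$, $a_1=\boldsymbol{\pi}_{*,*}\sum_l(A_{1,l}-A_{-1,l})\mathbf{1}$, $a_2=\boldsymbol{\pi}_{*,*}\sum_k(A_{k,1}-A_{k,-1})\mathbf{1}$. Standing assumptions: $\{\boldsymbol Y_n\}$ irreducible and aperiodic; $a_1<0$ or $a_2<0$; $P_+$ irreducible. $\Gamma=\{(\theta_1,\theta_2)\in\mathbb{R}^2:\mathrm{spr}(\sum_{k,l}e^{k\theta_1+l\theta_2}A_{k,l})<1\}$ (spr = spectral radius); $\langle\cdot,\cdot\rangle$ is the Euclidean inner product. *)

(* Defs.v *)
From mathcomp Require Import all_boot all_order all_algebra.
From mathcomp Require Import all_classical all_reals all_analysis.
From mathcomp Require Import complex.
Set Implicit Arguments. Unset Strict Implicit. Unset Printing Implicit Defensive.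
Import Order.TTheory GRing.Theory Num.Theory.
Local Open Scope ring_scope.

Section QBD2.
Variable R : realType.

Definition spr (n : nat) (M : 'M[R]_n) : R :=
  sup [set r : R | exists z : R[i],
         eigenvalue (map_mx (fun x : R => (x%:C)%C) M) z /\ r = ComplexField.Normc.normc z].

Variable s0 : nat.
Definition state := (int * int * 'I_s0)%type.

(** The blocks A_{k,l}, k,l in {-1,0,1}, are given as a function on int x int;
    only the values at k,l in {-1,0,1} are ever used. *)
Variable A : int -> int -> 'M[R]_s0.

Definition steps : seq int := [:: -1; 0; 1].

Definition trans (y y' : state) : R :=
  let k := (y'.1.1 - y.1.1)%R in
  let l := (y'.1.2 - y.1.2)%R in
  if (k \in steps) && (l \in steps) then A k l y.2 y'.2 else 0.

Definition succs (y : state) : seq state :=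
  [seq ((y.1.1 + u.1.1, y.1.2 + u.1.2)%R, u.2)
  | u <- [seq (kl, j) | kl <- [seq (k, l) | k <- steps, l <- steps],
                        j <- enum 'I_s0]].

Fixpoint pstep (n : nat) (y y' : state) : R :=
  match n with
  | 0 => (y == y')%:R
  | n.+1 => \sum_(z <- succs y) trans y z * pstep n z y'
  end.

Definition inSplus (y : state) : bool := (0 <= y.1.1)%R && (0 <= y.1.2)%R.

Fixpoint pplus (n : nat) (y y' : state) : R :=
  match n with
  | 0 => ((y == y') && inSplus y)%:R
  | n.+1 => (inSplus y)%:R * \sum_(z <- succs y) trans y z * pplus n z y'
  end.

(** expected number of visits to y' before leaving S_+, starting from y:
    E(sum_{n<tau} 1(Y_n = y')) = sum_n P(Y_n = y', n < tau) = sum_n P_+^n(y,y') *)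
Definition qtilde (y y' : state) : \bar R :=
  (\sum_(0 <= n <oo) ((pplus n y y')%:E))%E.

Definition irreducible_chain : Prop :=
  forall y y' : state, exists n, 0 < pstep n y y'.

Definition aperiodic_chain : Prop :=
  forall (y : state) (d : nat),
    (forall n, (0 < n)%N -> 0 < pstep n y y -> (d %| n)%N) -> d = 1%N.

Definition irreducible_Pplus : Prop :=
  forall y y' : state, inSplus y -> inSplus y' -> exists n, 0 < pplus n y y'.

Definition Asum : 'M[R]_s0 := \sum_(k <- steps) \sum_(l <- steps) A k l.

Definition drift1 (pi : 'rV[R]_s0) : R :=
  (pi *m (\sum_(l <- steps) (A 1 l - A (-1) l)) *m (const_mx 1 : 'cV[R]_s0)) 0 0.
Definition drift2 (pi : 'rV[R]_s0) : R :=
  (pi *m (\sum_(k <- steps) (A k 1 - A k (-1))) *m (const_mx 1 : 'cV[R]_s0)) 0 0.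

Definition Gamma : set (R * R) :=
  [set th | spr (\sum_(k <- steps) \sum_(l <- steps)
                  expR (k%:~R * th.1 + l%:~R * th.2) *: A k l) < 1].

End QBD2.

Definition elog {R : realType} (x : \bar R) : \bar R :=
  match x with
  | EFin r => if r <= 0 then -oo%E else (ln r)%:E
  | +oo%E => +oo%E
  | -oo%E => -oo%E
  end.

(* Main.v *)
Require Import Defs.
From mathcomp Require Import all_boot all_order all_algebra.
From mathcomp Require Import all_classical all_reals all_analysis.
From mathcomp Require Import complex.
From mathcomp Require Import zify ring lra.

(* Write [A(th)] for the exponentially tilted kernel, so that [Gamma] is the set
   of [th] such that [A(th)] admits a positive vector [v] with [A(th) v < v].

   Upper bound: for [th] in [Gamma], the function [e^<th,x> v] is contracted by
   the transition operator, whence [qtilde(y, y') = O(e^-<th,y'>)].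

   Lower bound: let [g] exceed the supremum.  Since [A(th)^n_jj <= 1] for all [n]
   would put [th] in the closure of [Gamma], compactness yields one [m] such that
   the convex function [phi(th) = A(th)^m_jj], the exponential moment of the loops
   of length [m] at [j], exceeds 1 on [<c,th> >= g] and outside a bounded set.  Let
   [th] maximize [<c,th>] on [phi <= 1]; by the Lagrange condition the loop
   weights tilted by [th] form a probability with mean [lam c], [lam > 0].  By
   a Chernoff bound and the pigeonhole principle a single displacement [v] close to
   [N lam c] is reached by [N] consecutive loops with weight
   [e^-<th,v> / O(N^2)].  Repeating this one displacement never leaves a
   translate of the quadrant, so killing costs only a constant factor, and the
   small difference with the direction [c] is corrected by unit steps. *)

Import Order.TTheory GRing.Theory Num.Theory.
Local Open Scope classical_set_scope.
Local Open Scope ring_scope.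
Set Implicit Arguments. Unset Strict Implicit. Unset Printing Implicit Defensive.

(** * Spectral radius of a nonnegative matrix *)

Section NonnegativeMatrix.
Variables (R : realType) (n : nat) (M : 'M[R]_n).
Hypothesis M_ge0 : forall i j, 0 <= M i j.

(** A strict Collatz-Wielandt certificate; [spr_lt1P] trades [spr M < 1] for its existence at level
    1, without any Perron eigenvector. *)
Definition subinvariant (x : R) (w : 'I_n -> R) : Prop :=
  (forall i, 0 < w i) /\ forall i, \sum_j M i j * w j < x * w i.

(** Pair the moduli of a left eigenvector with [w]: [|z| <|v|,w> <= <|v|M,w> = <|v|,Mw> <= r
    <|v|,w>], and the pairing is positive. *)
Lemma eigenvalue_norm_le (r : R) (w : 'I_n -> R) (z : R[i]) :
  (forall i, 0 < w i) -> (forall i, \sum_j M i j * w j <= r * w i) ->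
  eigenvalue (map_mx (fun x : R => (x%:C)%C) M) z ->
  ComplexField.Normc.normc z <= r.
Proof.
move=> w0 Mw /eigenvalueP[v vM vn0].
pose N := @ComplexField.Normc.normc R.
have N_ge0 y : 0 <= N y by case: y => a b; rewrite /N /= sqrtr_ge0.
have Nsum (I : Type) (s : seq I) (F : I -> R[i]) :
    N (\sum_(i <- s) F i) <= \sum_(i <- s) N (F i).
  elim/big_ind2: _ => [|x1 x2 y1 y2 h1 h2|//]; first by rewrite /N ComplexField.Normc.normc0.
  by apply: (le_trans (le_normcD _ _)); exact: lerD.
have NR (x : R) : 0 <= x -> N (x%:C)%C = x.
  by move=> x0; rewrite /N /= expr0n /= addr0 sqrtr_sqr ger0_norm.
have colE j : N z * N (v 0 j) <= \sum_i N (v 0 i) * M i j.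
  have /rowP/(_ j) := vM; rewrite !mxE => e.
  rewrite -[N z * _]ComplexField.Normc.normcM -e.
  apply: (le_trans (Nsum _ _ _)); apply: ler_sum => i _.
  by rewrite mxE [N _]ComplexField.Normc.normcM -/N NR.
pose S := \sum_j N (v 0 j) * w j.
have S_gt0 : 0 < S.
  rewrite lt_neqAle; apply/andP; split; last first.
    by apply: sumr_ge0 => j _; rewrite mulr_ge0 // ltW.
  apply/eqP => /esym/eqP; rewrite psumr_eq0; last first.
    by move=> j _; rewrite mulr_ge0 // ltW.
  move=> /allP h; move/eqP: vn0; apply; apply/rowP => j; rewrite mxE.
  have := h j (mem_index_enum j); rewrite /= mulf_eq0 (gt_eqF (w0 j)) orbF.
  by move=> /eqP /ComplexField.Normc.eq0_normc.
rewrite -(ler_pM2r S_gt0) -/N mulr_sumr.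
apply: (@le_trans _ _ (\sum_j (\sum_i N (v 0 i) * M i j) * w j)).
  by apply: ler_sum => j _; rewrite mulrA ler_wpM2r // ltW.
under eq_bigr do rewrite mulr_suml.
rewrite exchange_big /= mulr_sumr; apply: ler_sum => i _.
under eq_bigr do rewrite -mulrA.
by rewrite -mulr_sumr mulrCA ler_wpM2l.
Qed.

Lemma spr_le (r : R) (w : 'I_n -> R) : 0 <= r ->
  (forall i, 0 < w i) -> (forall i, \sum_j M i j * w j <= r * w i) ->
  spr M <= r.
Proof.
move=> r0 w0 Mw; rewrite /spr; set E := [set _ | _].
have [->|/set0P En0] := eqVneq E set0; first by rewrite sup0.
by apply: ge_sup => // _ [z [ez ->]]; exact: (eigenvalue_norm_le w0 Mw).
Qed.

Lemma positive_lower_bound (m : nat) (f : 'I_m -> R) :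
  (forall i, 0 < f i) -> exists2 e, 0 < e & forall i, e <= f i.
Proof.
(* The default 1 keeps the minimum positive when the index set is empty. *)
move=> f0; exists (\big[Num.min/1]_i f i); last by move=> i; exact: bigmin_le.
by apply: lt_bigmin.
Qed.

Lemma subinvariant_le (x y : R) (w : 'I_n -> R) :
  x <= y -> subinvariant x w -> subinvariant y w.
Proof.
move=> xy [w0 h]; split=> // i; apply: (lt_le_trans (h i)).
by rewrite ler_wpM2r // ltW.
Qed.

Lemma subinvariant_open (x : R) (w : 'I_n -> R) : subinvariant x w ->
  exists2 e, 0 < e & forall i, \sum_j M i j * w j <= (x - e) * w i.
Proof.
move=> [w0 h].
have [|e e0 he] := @positive_lower_bound _ (fun i => x - (\sum_j M i j * w j) / w i).
  by move=> i; rewrite subr_gt0 ltr_pdivrMr.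
exists e => // i; have := he i.
by rewrite lerBrDr -lerBrDl ler_pdivrMr.
Qed.

(* Compare [u] with the smallest multiple [a w] such that [u + a w >= 0]. *)
Lemma minimum_principle (x : R) (w u : 'I_n -> R) : subinvariant x w ->
  (forall i, \sum_j M i j * u j <= x * u i) -> forall i, 0 <= u i.
Proof.
move=> [w0 h] hu i0; rewrite leNgt; apply/negP => ui0.
pose i := [arg min_(i < i0) (u i / w i)]%O.
have him k : u i / w i <= u k / w k.
  by rewrite /i; case: arg_minP => // i' _ /(_ k isT).
pose a := - (u i / w i).
have a_gt0 : 0 < a.
  by rewrite oppr_gt0 (le_lt_trans (him i0)) // pmulr_llt0 // invr_gt0.
have v_ge0 k : 0 <= u k + a * w k.
  by rewrite /a mulNr subr_ge0 -ler_pdivlMr.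
have vi : u i + a * w i = 0 by rewrite /a mulNr divfK ?subrr // gt_eqF.
have : 0 <= \sum_j M i j * (u j + a * w j).
  by apply: sumr_ge0 => j _; rewrite mulr_ge0.
apply/negP; rewrite -ltNge.
under eq_bigr do rewrite mulrDr.
rewrite big_split /=.
have -> : \sum_j M i j * (a * w j) = a * \sum_j M i j * w j.
  by rewrite mulr_sumr; apply: eq_bigr => j _; rewrite mulrCA.
apply: (@lt_le_trans _ _ (x * u i + a * (x * w i))).
  by apply: ler_ltD => //; rewrite ltr_pM2l.
by rewrite mulrCA -mulrDr vi mulr0.
Qed.

Lemma sum_ord_le (m : nat) (f : 'I_m -> R) : (forall i, 0 <= f i) ->
  forall i, f i <= \sum_i f i.
Proof. by move=> f0 i; rewrite (bigD1 i) //= lerDl sumr_ge0. Qed.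

Lemma eigenvalue_le_spr (x : R) : 0 <= x -> eigenvalue M x -> x <= spr M.
Proof.
move=> x0 ex; rewrite /spr; apply: ub_le_sup.
  exists (\sum_i \sum_j M i j) => _ [z [ez ->]].
  apply: (@eigenvalue_norm_le _ (fun _ => 1)) ez => // i; rewrite mulr1.
  under eq_bigr do rewrite mulr1.
  by apply: (@sum_ord_le _ (fun i => \sum_j M i j)) => k; apply: sumr_ge0.
exists (x%:C)%C; split; last by rewrite /= expr0n /= addr0 sqrtr_sqr ger0_norm.
by rewrite (eigenvalue_map (real_complex R)).
Qed.

(** Otherwise the infimum [x] of all subinvariant levels is at least [x0], so it exceeds [spr M] and
    [x - M] is invertible. The solution of [(x - M) u = 1] is nonnegative by the minimum principle
    at a level just above [x], so [u] is subinvariant at [x] itself; openness of the inequality then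
    gives a level below the infimum. *)
Lemma subinvariant_of_spr (x0 : R) : 0 < x0 -> spr M < x0 ->
  exists w, subinvariant x0 w.
Proof.
move=> x00 sM; apply: contrapT => hno.
pose T := [set x : R | exists w, subinvariant x w].
have T_lb : lbound T x0.
  move=> x [w hw]; rewrite leNgt; apply/negP => xx0; apply: hno; exists w.
  by apply: subinvariant_le hw; exact: ltW.
have T0 : T !=set0.
  exists (\sum_i \sum_j M i j + 1), (fun _ => 1); split=> // i.
  rewrite mulr1; under eq_bigr do rewrite mulr1.
  apply: (@le_lt_trans _ _ (\sum_i \sum_j M i j)); last by rewrite ltrDl.
  by apply: (@sum_ord_le _ (fun i => \sum_j M i j)) => k; apply: sumr_ge0.
have T_inf : has_inf T by split => //; exists x0.
pose x := inf T.
have x_ge : x0 <= x by apply: lb_le_inf.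
have x_gt0 : 0 < x by exact: lt_le_trans x_ge.
have [u hu] : exists u : 'I_n -> R, forall i, \sum_j M i j * u j = x * u i - 1.
  have xM : x%:M - M \in unitmx.
    rewrite unitmxE unitfE; apply/negP => /eqP dt.
    have : eigenvalue M x.
      rewrite eigenvalue_root_char /root /char_poly.
      apply/eqP; rewrite -horner_evalE -det_map_mx -dt; congr (\det _).
      apply/matrixP => i j; rewrite !mxE /= /horner_eval hornerD hornerN.
      by rewrite hornerMn hornerX hornerC.
    by move/(eigenvalue_le_spr (ltW x_gt0)); rewrite leNgt (lt_le_trans sM).
  pose u := invmx (x%:M - M) *m (const_mx 1 : 'cV_n).
  exists (fun i => u i 0) => i.
  have /colP/(_ i) : (x%:M - M) *m u = const_mx 1 by rewrite mulKVmx.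
  rewrite mulmxBl mul_scalar_mx !mxE => h.
  by move: h => /eqP; rewrite subr_eq => /eqP ->; rewrite addrAC subrr add0r.
have [e e0 he] : exists2 e, 0 < e & forall i, e * `|u i| <= 1.
  exists (1 + \sum_i `|u i|)^-1; first by rewrite invr_gt0 ltr_wpDr // sumr_ge0.
  move=> i; rewrite mulrC ler_pdivrMr ?mul1r; last by rewrite ltr_wpDr // sumr_ge0.
  by apply: (le_trans (@sum_ord_le _ (fun i => `|u i|) _ i)) => //; rewrite lerDr.
have u_ge0 : forall i, 0 <= u i.
  have [y [w hw] yx] := inf_adherent e0 T_inf.
  apply: (minimum_principle hw) => i; rewrite hu.
  have hxy : 0 <= y - x by rewrite subr_ge0; apply: ge_inf; [case: T_inf | exists w].
  rewrite lerBlDr -subr_ge0 addrAC -mulrBl.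
  have h1 : - 1 <= (y - x) * u i.
    rewrite lerNl -mulrN; apply: le_trans (he i).
    apply: (@le_trans _ _ ((y - x) * `|u i|)).
      by rewrite ler_wpM2l // -normrN ler_norm.
    by rewrite ler_wpM2r // lerBlDl ltW // /x.
  by rewrite -(lerD2r (- 1)) add0r addrK.
have uu : subinvariant x u.
  have h i : \sum_j M i j * u j < x * u i by rewrite hu ltrBlDr ltrDl.
  split=> // i; rewrite -(pmulr_rgt0 _ x_gt0).
  by apply: le_lt_trans (h i); apply: sumr_ge0 => j _; rewrite mulr_ge0.
have [d d0 hd] := subinvariant_open uu.
have : T (x - d / 2).
  exists u; split => [|i]; first by case: uu.
  apply: (le_lt_trans (hd i)); rewrite ltr_pM2r; last by case: uu.
  by rewrite ltrD2l ltrN2 ltr_pdivrMr // mulr_natr mulr2n ltrDl.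
move=> /(ge_inf (proj2 T_inf)); rewrite leNgt => /negP; apply.
by rewrite ltrBlDr ltrDl divr_gt0.
Qed.

Lemma spr_lt1P : spr M < 1 <-> exists w, subinvariant 1 w.
Proof.
split; first exact: subinvariant_of_spr.
move=> [w [w0 /= Mw]].
have [e e0 he] : exists2 e : R, 0 < e & forall i, \sum_j M i j * w j <= (1 - e) * w i.
  exact: subinvariant_open.
apply: (@le_lt_trans _ _ (Num.max 0 (1 - e))).
  apply: (@spr_le _ w) => //; first by rewrite le_max lexx.
  move=> i; apply: (le_trans (he i)).
  by rewrite ler_wpM2r ?(ltW (w0 _)) // le_max lexx orbT.
by rewrite gt_max ltr01 ltrBlDr ltrDl.
Qed.

End NonnegativeMatrix.

(** * Transition operators *)

Section FiniteKernel.
Variables (R : realType) (T : eqType) (succ : T -> seq T) (w : T -> T -> R).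
Hypothesis w_ge0 : forall y z, 0 <= w y z.

Definition kop (F : T -> R) (y : T) : R := \sum_(z <- succ y) w y z * F z.
Definition kit (n : nat) (F : T -> R) : T -> R := iter n kop F.
Definition dirac_at (z y : T) : R := (y == z)%:R.

Lemma dirac_at_ge0 z y : 0 <= dirac_at z y.
Proof. by rewrite /dirac_at ler0n. Qed.

Lemma kitS n F y : kit n.+1 F y = kop (kit n F) y.
Proof. by []. Qed.

Lemma kitD m n F : kit (m + n) F = kit m (kit n F).
Proof. by rewrite /kit iterD. Qed.

Lemma kop_le F G y : (forall z, F z <= G z) -> kop F y <= kop G y.
Proof. by move=> FG; apply: ler_sum => z _; rewrite ler_wpM2l. Qed.

Lemma kit_le n F G y : (forall z, F z <= G z) -> kit n F y <= kit n G y.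
Proof.
by move=> FG; elim: n y => [|n IH] y; [exact: FG | rewrite !kitS; exact: kop_le].
Qed.

Lemma kit_ge0 n F y : (forall z, 0 <= F z) -> 0 <= kit n F y.
Proof.
move=> F0; elim: n y => [|n IH] y; [exact: F0 | apply: sumr_ge0 => z _].
by rewrite mulr_ge0 //; exact: IH.
Qed.

Lemma kit_sum n (I : Type) (r : seq I) (a : I -> R) (F : I -> T -> R) y :
  kit n (fun z => \sum_(i <- r) a i * F i z) y = \sum_(i <- r) a i * kit n (F i) y.
Proof.
elim: n y => // n IH y; rewrite kitS /kop.
under eq_bigr do rewrite IH mulr_sumr.
rewrite exchange_big /=; apply: eq_bigr => i _; rewrite mulr_sumr.
by apply: eq_bigr => z _; rewrite mulrCA.
Qed.

Lemma kitZ n a F y : kit n (fun z => a * F z) y = a * kit n F y.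
Proof.
have := kit_sum n [:: tt] (fun _ => a) (fun _ => F) y.
by under [X in kit n X]eq_fun do rewrite big_seq1; rewrite big_seq1.
Qed.

Lemma kit_super n (r : R) F y : 0 <= r -> (forall z, kop F z <= r * F z) ->
  kit n F y <= r ^+ n * F y.
Proof.
move=> r0 h; elim: n y => [|n IH] y; first by rewrite expr0 mul1r.
rewrite -addn1 kitD exprD expr1 -mulrA.
apply: (@le_trans _ _ (kit n (fun z => r * F z) y)); first exact: kit_le.
by rewrite kitZ mulrCA ler_wpM2l.
Qed.

Lemma kit_sub n (r : R) F y : 0 <= r -> (forall z, r * F z <= kop F z) ->
  r ^+ n * F y <= kit n F y.
Proof.
move=> r0 h; elim: n y => [|n IH] y; first by rewrite expr0 mul1r.
rewrite -addn1 kitD exprD expr1 -mulrA.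
apply: (@le_trans _ _ (kit n (fun z => r * F z) y)); last exact: kit_le.
by rewrite kitZ mulrCA ler_wpM2l.
Qed.

Lemma dirac_at_sum (L : seq T) F y : uniq L ->
  \sum_(z <- L) F z * dirac_at z y = if y \in L then F y else 0.
Proof.
move=> uL; case: ifPn => yL.
  rewrite (bigD1_seq y) //= /dirac_at eqxx mulr1 big1 ?addr0 // => z zy.
  by rewrite eq_sym (negbTE zy) mulr0.
rewrite big1_seq // => z /andP[_ zL]; rewrite /dirac_at.
by case: eqP => [yz|]; rewrite ?mulr0 //; rewrite yz zL in yL.
Qed.

Lemma kit_ge_sum n (L : seq T) F y : uniq L -> (forall z, 0 <= F z) ->
  \sum_(z <- L) F z * kit n (dirac_at z) y <= kit n F y.
Proof.
move=> uL F0; rewrite -kit_sum; apply: kit_le => z.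
by rewrite dirac_at_sum //; case: ifP.
Qed.

Lemma kit_ge1 n F y z : (forall z, 0 <= F z) ->
  F z * kit n (dirac_at z) y <= kit n F y.
Proof. by move=> F0; have := @kit_ge_sum n [:: z] F y isT F0; rewrite big_seq1. Qed.

Lemma kit_comp m n F x y : (forall z, 0 <= F z) ->
  kit m (dirac_at y) x * kit n F y <= kit (m + n) F x.
Proof.
by move=> F0; rewrite kitD mulrC; apply: kit_ge1 => z; exact: kit_ge0.
Qed.

(** Only the endpoints of [n]-step paths are constrained, not the intermediate points: the value of
    [kit n F] depends on [F] at endpoints only. *)
Fixpoint confined (L : pred T) (n : nat) (y : T) : Prop :=
  if n is n'.+1 then forall z, z \in succ y -> confined L n' z else L y.

Lemma kit_eq_confined (L : pred T) n F G y : confined L n y ->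
  (forall z, L z -> F z = G z) -> kit n F y = kit n G y.
Proof.
move=> cn FG; elim: n y cn => [|n IH] y /= cn; first exact: FG.
by apply: eq_big_seq => z zy; rewrite IH //; exact: cn.
Qed.

Lemma kit_eq_sum n (L : seq T) F y : uniq L -> confined [pred z | z \in L] n y ->
  kit n F y = \sum_(z <- L) F z * kit n (dirac_at z) y.
Proof.
move=> uL cn; rewrite -kit_sum; apply: (kit_eq_confined cn) => z /= zL.
by rewrite dirac_at_sum // zL.
Qed.

Lemma kit_equivariant (f : T -> T) :
  (forall F y, kop (F \o f) y = kop F (f y)) ->
  forall n F y, kit n (F \o f) y = kit n F (f y).
Proof.
move=> hf n F; elim: n => // n IH y.
by rewrite !kitS -hf; apply: eq_bigr => z _; rewrite IH.
Qed.

End FiniteKernel.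

(** * The chain without killing, its translations and exponential tilts *)

Section Chain.
Variables (R : realType) (s0 : nat) (A : int -> int -> 'M[R]_s0).
Hypothesis A_ge0 : forall k l i j, 0 <= A k l i j.

Local Notation K := (kop (@succs s0) (trans A)).
Local Notation Kit := (kit (@succs s0) (trans A)).

Lemma trans_ge0 y z : 0 <= trans A y z.
Proof. by rewrite /trans; case: ifP. Qed.

Lemma pstepE n y y' : pstep A n y y' = Kit n (dirac_at R y') y.
Proof. by elim: n y => // n IH y; rewrite kitS; apply: eq_bigr => z _; congr (_ * _); exact: IH. Qed.

Lemma succsP (y z : state s0) : reflect
  (exists k l j, [/\ k \in steps, l \in steps & z = (y.1 + (k, l), j)])
  (z \in succs y).
Proof.
apply: (iffP mapP) => [[[kl j]]|[k [l [j [hk hl ->]]]]].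
  move=> hm ->; case: (allpairsPdep hm) => kl' [j' [hkl _ [-> ->]]].
  by case: (allpairsPdep hkl) => k [l [hk hl ->]]; exists k, l, j'.
exists ((k, l), j) => //; apply: allpairs_f; last by rewrite mem_enum.
exact: allpairs_f.
Qed.

Lemma stepE (F : state s0 -> R) y :
  K F y = \sum_(k <- steps) \sum_(l <- steps) \sum_j
            A k l y.2 j * F (y.1 + (k, l), j).
Proof.
rewrite /kop /succs big_map big_allpairs big_allpairs.
rewrite [LHS]big_seq [RHS]big_seq; apply: eq_bigr => k hk.
rewrite [LHS]big_seq [RHS]big_seq; apply: eq_bigr => l hl.
rewrite big_enum /=; apply: eq_bigr => j _.
rewrite /trans /= ![_.1.1 + _]addrC ![_.1.2 + _]addrC !addrK hk hl /=.
by congr (_ * F (_, _)); rewrite [RHS]addrC.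
Qed.

Definition translate (x : int * int) (y : state s0) : state s0 := (x + y.1, y.2).

Lemma Kit_shift n F x y : Kit n (F \o translate x) y = Kit n F (translate x y).
Proof.
apply: kit_equivariant => {}F {}y; rewrite !stepE.
do 2 (apply: eq_bigr => ? _); apply: eq_bigr => j _.
by rewrite /translate /= addrA.
Qed.

Definition dot (th : R * R) (x : int * int) : R :=
  x.1%:~R * th.1 + x.2%:~R * th.2.
Definition ew (th : R * R) (x : int * int) : R := expR (dot th x).

Lemma ewD th x y : ew th (x + y) = ew th x * ew th y.
Proof. by rewrite /ew -expRD /dot /= !rmorphD /= !mulrDl addrACA. Qed.

Lemma ew0 th : ew th 0 = 1.
Proof. by rewrite /ew /dot /= !mul0r addr0 expR0. Qed.

Lemma ew_gt0 th x : 0 < ew th x.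
Proof. exact: expR_gt0. Qed.

(** On these product functions the chain acts on the second factor alone, through the matrix
    [twisted th]; see [Kit_tilt] and [twistedE]. *)
Definition tilt (th : R * R) (v : 'I_s0 -> R) (z : state s0) : R :=
  ew th z.1 * v z.2.

Lemma tilt_ge0 th v z : (forall i, 0 <= v i) -> 0 <= tilt th v z.
Proof. by move=> v0; rewrite mulr_ge0 // ltW // ew_gt0. Qed.

Lemma tilt_shift th v x : tilt th v \o translate x = fun y => ew th x * tilt th v y.
Proof. by apply/funext => y; rewrite /= /tilt /translate /= ewD mulrA. Qed.

Lemma Kit_tilt n th v y : Kit n (tilt th v) y =
  ew th y.1 * Kit n (tilt th v) (0, y.2).
Proof.
have {1}-> : y = translate y.1 (0, y.2) by case: y => x i; rewrite /translate /= addr0.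
by rewrite -Kit_shift tilt_shift kitZ.
Qed.

Definition twisted (th : R * R) : 'M[R]_s0 :=
  \sum_(k <- steps) \sum_(l <- steps) expR (k%:~R * th.1 + l%:~R * th.2) *: A k l.

Lemma twistedE th v i : K (tilt th v) (0, i) = \sum_j twisted th i j * v j.
Proof.
rewrite stepE.
under [RHS]eq_bigr do rewrite /twisted summxE mulr_suml.
rewrite [RHS]exchange_big; apply: eq_bigr => k _ /=.
under [RHS]eq_bigr do rewrite summxE mulr_suml.
rewrite [RHS]exchange_big; apply: eq_bigr => l _ /=.
apply: eq_bigr => j _; rewrite mxE /tilt /= add0r.
by rewrite mulrCA mulrA.
Qed.

Lemma twisted_ge0 th i j : 0 <= twisted th i j.
Proof.
rewrite summxE sumr_ge0 // => k _; rewrite summxE sumr_ge0 // => l _.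
by rewrite mxE mulr_ge0 // expR_ge0.
Qed.

Lemma GammaP th : Gamma A th <->
  exists v, (forall i, 0 < v i) /\ forall i, K (tilt th v) (0, i) < v i.
Proof.
have := spr_lt1P (twisted_ge0 th); rewrite /Gamma /= => ->.
split=> -[v [v0 h]]; exists v; split=> // i; have := h i.
  by rewrite mul1r twistedE.
by rewrite mul1r -twistedE.
Qed.

Lemma Gamma_contraction th : Gamma A th ->
  exists v r, [/\ (forall i, 0 < v i), 0 < r, r < 1 &
                 forall y, K (tilt th v) y <= r * tilt th v y].
Proof.
move=> /GammaP[v [v0 h]].
have hs : subinvariant (twisted th) 1 v.
  by split=> // i; rewrite -twistedE mul1r.
have [e e0 he] := subinvariant_open hs.
(* [1 - e] need not be positive; the maximum with 1/2 secures [0 < r]. *)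
exists v, (Num.max (1 - e) (1 / 2)); split=> //.
- by rewrite lt_max; apply/orP; right; rewrite divr_gt0.
- by rewrite gt_max ltrBlDr ltrDl e0 /=; lra.
move=> y; have := Kit_tilt 1 th v y; rewrite /kit /= => ->.
rewrite /tilt mulrCA ler_wpM2l ?(ltW (ew_gt0 _ _)) // twistedE.
apply: (le_trans (he _)); rewrite ler_wpM2r ?(ltW (v0 _)) //.
by rewrite le_max lexx.
Qed.

(** This is the diagonal entry at [j] of the [n]-th power of [twisted th]. *)
Definition phi (j : 'I_s0) (n : nat) (th : R * R) : R :=
  Kit n (tilt th (fun i => (i == j)%:R)) (0, j).

Lemma phi_ge0 j n th : 0 <= phi j n th.
Proof. by apply: kit_ge0 => [y z|z]; [exact: trans_ge0 | apply: tilt_ge0]. Qed.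

Lemma phi_exp j a b th : phi j a th ^+ b <= phi j (b * a) th.
Proof.
set F := tilt th (fun i => (i == j)%:R).
have F0 z : 0 <= F z by exact: tilt_ge0.
have h z : phi j a th * F z <= Kit a F z.
  rewrite Kit_tilt mulrC /F /tilt -/F; case: eqP => [->|_].
    by rewrite mulr1 ler_wpM2l ?(ltW (ew_gt0 _ _)).
  rewrite mulr0 mul0r mulr_ge0 ?(ltW (ew_gt0 _ _)) //.
  exact: (kit_ge0 _ trans_ge0).
elim: b => [|b IH].
  by rewrite expr0 /phi /= /tilt ew0 eqxx mulr1.
rewrite exprS mulSn addnC /phi kitD.
apply: (@le_trans _ _ (Kit (b * a) (fun z => phi j a th * F z) (0, j))).
  by rewrite kitZ ler_wpM2l // phi_ge0.
by apply: (kit_le _ trans_ge0) => z; exact: h.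
Qed.

(** Since [v_j 1_j <= v], iterating the contraction and evaluating at [j] bounds [v_j phi] by
    [r^n v_j]; on the diagonal the constant cancels. *)
Lemma phi_le_geometric th : Gamma A th -> exists2 r, 0 < r < 1 &
  forall j n, phi j n th <= r ^+ n.
Proof.
move=> /Gamma_contraction[v [r [v0 r0 r1 h]]].
exists r; first by rewrite r0.
move=> j n; have vj := v0 j.
have := kit_super trans_ge0 n (0, j) (ltW r0) h.
have -> : tilt th v (0, j) = v j by rewrite /tilt ew0 mul1r.
move=> hk; rewrite -(ler_pM2r vj); apply: le_trans hk.
rewrite mulrC /phi -kitZ; apply: (kit_le _ trans_ge0) => z; rewrite /tilt.
rewrite mulrCA ler_wpM2l ?(ltW (ew_gt0 _ _)) //.
by case: eqP => [->|]; rewrite ?mulr1 ?mulr0 // ltW.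
Qed.

End Chain.

(** * Convexity of the domain *)

Lemma small_power (R : realType) (x e : R) (N0 : nat) : 0 <= x < 1 -> 0 < e ->
  exists2 N, (N0 <= N)%N & x ^+ N < e.
Proof.
move=> /andP[x0 x1] e0.
have /cvgrPdist_lt/(_ e e0) : (fun n => x ^+ n) @ \oo --> 0.
  by apply: cvg_expr; rewrite ger0_norm.
move=> [N _ hN]; exists (maxn N0 N); first exact: leq_maxl.
by have := hN (maxn N0 N) (leq_maxr _ _); rewrite /= sub0r normrN ger0_norm // exprn_ge0.
Qed.

Lemma expR_convex (R : realType) (t a b : R) : 0 <= t <= 1 ->
  expR ((1 - t) * a + t * b) <= (1 - t) * expR a + t * expR b.
Proof.
move=> /andP[t0 t1]; have := convex_expR (Itv01 t0 t1) b a.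
by rewrite !convRE /= ![t * _ + _]addrC.
Qed.

Lemma expR_le_quadratic (R : realType) (x : R) : x <= 1 / 2 ->
  expR x <= 1 + x + 2 * x ^+ 2.
Proof.
move=> x1; have x2 : 0 < 1 - x by lra.
have : expR x <= (1 - x)^-1.
  by rewrite -[x in expR x]opprK expRN lef_pV2 ?posrE ?expR_gt0 // expR_ge1Dx.
move=> /le_trans; apply; rewrite -[_^-1]mul1r ler_pdivrMr //.
have -> : (1 + x + 2 * x ^+ 2) * (1 - x) = 1 + x ^+ 2 * (1 - 2 * x) by ring.
by rewrite lerDl mulr_ge0 ?sqr_ge0 //; lra.
Qed.

Section ChainConvexity.
Variables (R : realType) (s0 : nat) (A : int -> int -> 'M[R]_s0).
Hypothesis A_ge0 : forall k l i j, 0 <= A k l i j.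
Hypothesis irr : irreducible_chain A.

Local Notation K := (kop (@succs s0) (trans A)).
Local Notation Kit := (kit (@succs s0) (trans A)).
Let t_ge0 := trans_ge0 A_ge0.

(* The subinvariant vector is a partial sum of [sum_n rho^n A(th)^n 1_j] with
   [1 < rho < 1/q]. *)
Lemma Gamma_of_geometric (j : 'I_s0) (q : R) th : 0 < q < 1 ->
  (forall n, phi A j n th <= q ^+ n) -> Gamma A th.
Proof.
move=> /andP[q0 q1] hq.
set F := tilt th (fun i => (i == j)%:R).
have F0 z : 0 <= F z by exact: tilt_ge0.
pose H n i := Kit n F (0, i).
have H0 n i : 0 <= H n i by exact: kit_ge0.
have H_le i : exists2 C, 0 < C & forall n, H n i <= C * q ^+ n.
  have [m] := irr (0, j) (0, i); rewrite pstepE => dm.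
  exists (Kit m (dirac_at R (0, i)) (0, j))^-1; first by rewrite invr_gt0.
  move=> n; rewrite ler_pdivlMl //.
  apply: (le_trans (@kit_comp _ _ _ _ t_ge0 m n F (0, j) (0, i) F0)).
  apply: (le_trans (hq _)); rewrite exprD ger_pMl ?exprn_gt0 //.
  by rewrite exprn_ile1 // ltW.
have H_gt i : exists n, 0 < H n i.
  have [m] := irr (0, i) (0, j); rewrite pstepE => dm; exists m.
  apply: (lt_le_trans _ (@kit_ge1 _ _ _ _ t_ge0 m F (0, i) (0, j) F0)).
  by rewrite mulr_gt0 // /F /tilt eqxx mulr1 ew_gt0.
have /choice[m hm] := H_gt.
have /choice[C hC] : forall i, exists C, 0 < C /\ forall n, H n i <= C * q ^+ n.
  by move=> i; have [C] := H_le i; exists C.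
(* With [p = sqrt q] and [rho = 1/p], the boundary term [rho^N H N i] is at most [C i p^N], which
   tends to 0. *)
pose p := Num.sqrt q; have pp : p * p = q by rewrite -expr2 sqr_sqrtr // ltW.
have p0 : 0 < p by rewrite sqrtr_gt0.
have p1 : p < 1 by rewrite -sqrtr1 ltr_sqrt.
pose rho := p^-1; have rho0 : 0 < rho by rewrite invr_gt0.
have rho1 : 1 < rho by rewrite invf_gt1.
pose w N i := \sum_(0 <= n < N) rho ^+ n * H n i.
have w_le N i : (m i < N)%N -> rho ^+ m i * H (m i) i <= w N i.
  move=> mN; rewrite /w big_mkord.
  have := @sum_ord_le _ _ (fun n : 'I_N => rho ^+ n * H n i) _ (Ordinal mN).
  by apply => n; rewrite mulr_ge0 // exprn_ge0 // ltW.
(* Telescoping leaves [rho^N H N i < (rho - 1) w N i] to be shown; the term of index [m i] bounds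
   [w N i] below independently of [N], once [N] exceeds [m i]. *)
have [|k k0 hk] := @positive_lower_bound _ _ (fun i => (rho - 1) * (rho ^+ m i * H (m i) i) / C i).
  move=> i; rewrite divr_gt0 //; last by case: (hC i).
  by rewrite mulr_gt0 ?subr_gt0 // mulr_gt0 ?exprn_gt0.
have [|N mN pN] := @small_power _ p k (\sum_i m i).+1 _ k0.
  by rewrite (ltW p0).
have mNi i : (m i < N)%N by apply: leq_trans mN; rewrite ltnS (bigD1 i) //= leq_addr.
apply/(GammaP A_ge0); exists (w N); split=> i.
  apply: lt_le_trans (w_le _ _ (mNi i)).
  by rewrite mulr_gt0 ?exprn_gt0.
have -> : K (tilt th (w N)) (0, i) = \sum_(0 <= n < N) rho ^+ n * H n.+1 i.
  have -> : tilt th (w N) = (fun z => \sum_(0 <= n < N) rho ^+ n * Kit n F z).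
    apply/funext => z; rewrite /tilt /w mulr_sumr; apply: eq_bigr => n _.
    by rewrite [in RHS]Kit_tilt mulrCA.
  exact: (kit_sum _ _ 1).
rewrite -(ltr_pM2l rho0) mulr_sumr.
under eq_bigr do rewrite mulrA -exprS.
have e : \sum_(0 <= n < N) rho ^+ n.+1 * H n.+1 i + H 0%N i = w N i + rho ^+ N * H N i.
  rewrite /w -big_nat_recr //= big_nat_recl //= expr0 mul1r addrC.
  by congr (_ + _); rewrite big_add1.
have {e}e : \sum_(0 <= n < N) rho ^+ n.+1 * H n.+1 i <= w N i + rho ^+ N * H N i.
  by rewrite -e lerDl.
apply: (le_lt_trans e); rewrite -ltrBrDl -[X in _ - X]mul1r -mulrBl.
have C0 : 0 < C i by case: (hC i).
apply: (@le_lt_trans _ _ (C i * p ^+ N)).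
  have [_ /(_ N) hh] := hC i.
  apply: (@le_trans _ _ (rho ^+ N * (C i * q ^+ N))).
    by rewrite ler_wpM2l // exprn_ge0 // ltW.
  rewrite mulrCA ler_pM2l // -exprMn -pp mulrA mulVf ?mul1r // gt_eqF //.
rewrite mulrC -ltr_pdivlMr //; apply: (lt_le_trans pN); apply: (le_trans (hk i)).
rewrite ler_pM2r ?invr_gt0 // ler_pM2l ?subr_gt0 //.
exact: w_le.
Qed.

(** The weighted arithmetic-geometric inequality between [e^<th,x>] and [r^-n e^<th0,x>], summed
    over loops of length [n], bounds [phi] at the interpolated point by [r^(t n)]. Thus a [th] with
    all [phi <= 1] is a limit of points of [Gamma]. *)
Lemma Gamma_segment (j : 'I_s0) (t : R) th th0 : 0 < t < 1 ->
  Gamma A th0 -> (forall n, phi A j n th <= 1) ->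
  Gamma A ((1 - t) * th.1 + t * th0.1, (1 - t) * th.2 + t * th0.2).
Proof.
move=> /andP[t0 t1] G0 h1; set tht := (_, _).
have [r /andP[r0 r1] hr] := phi_le_geometric A_ge0 G0.
pose q := expR (t * ln r).
apply: (@Gamma_of_geometric j q).
  by rewrite expR_gt0 /= -expR0 ltr_expR pmulr_rlt0 // ln_lt0 // r0.
move=> n; rewrite -expRM_natl -[leRHS]mul1r -ler_pdivrMr ?expR_gt0 // -expRN.
rewrite mulrC /phi -kitZ.
pose F th (z : state s0) : R := tilt th (fun i => (i == j)%:R) z.
apply: (@le_trans _ _ (Kit n (fun z => \sum_(b <- [:: true; false])
   (if b then 1 - t else t * expR (- ln r *+ n)) * F (if b then th else th0) z) (0, j))).
  apply: (kit_le _ t_ge0) => -[x i]; rewrite !big_cons big_nil addr0 /F /tilt /=.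
  case: eqP => _; last by rewrite !mulr0 addr0.
  rewrite !mulr1 -mulrA -!expRD.
  apply: le_trans (expR_convex _ _ _); last by rewrite !ltW.
  rewrite ler_expR le_eqVlt; apply/orP; left; apply/eqP; rewrite /dot /=.
  rewrite -mulr_natl; ring.
rewrite kit_sum !big_cons big_nil addr0 -!/(phi _ _ _ _).
rewrite -[leRHS](subrK t); apply: lerD; first by rewrite ger_pMr ?subr_gt0.
rewrite -mulrA ger_pMr //.
apply: (@le_trans _ _ (expR (- ln r *+ n) * r ^+ n)).
  by rewrite ler_wpM2l ?expR_ge0.
by rewrite -mulr_natl expRM_natl expRN lnK // exprVn mulVf // expf_neq0 // gt_eqF.
Qed.

End ChainConvexity.

(** * Nonemptiness of the domain from the drift *)

Section Poisson.
Variables (R : realType) (s0 : nat) (A : int -> int -> 'M[R]_s0) (pi : 'rV[R]_s0).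
Hypothesis A_ge0 : forall k l i j, 0 <= A k l i j.
Hypothesis A_stoch : forall i, \sum_(j < s0) Asum A i j = 1.
Hypothesis irr : irreducible_chain A.
Hypothesis pi_sum : \sum_(j < s0) pi 0 j = 1.
Hypothesis pi_stat : pi *m Asum A = pi.

Local Notation K := (kop (@succs s0) (trans A)).
Local Notation Kit := (kit (@succs s0) (trans A)).
Let t_ge0 := trans_ge0 A_ge0.

Lemma kop_level (g : 'I_s0 -> R) y : K (fun z => g z.2) y = \sum_j Asum A y.2 j * g j.
Proof.
rewrite stepE.
under [RHS]eq_bigr do rewrite /Asum summxE mulr_suml.
rewrite [RHS]exchange_big; apply: eq_bigr => k _ /=.
under [RHS]eq_bigr do rewrite summxE mulr_suml.
by rewrite [RHS]exchange_big; apply: eq_bigr.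
Qed.

(** At a maximum point [i0] the function [g i0 - g] is nonnegative, harmonic and zero, so it
    vanishes at every state reachable from [i0]. *)
Lemma harmonic_const (g : 'I_s0 -> R) :
  (forall i, \sum_j Asum A i j * g j = g i) -> forall i j, g i = g j.
Proof.
move=> hg.
suff h i0 : (forall j, g j <= g i0) -> forall j, g j = g i0.
  move=> i j; pose i0 := [arg max_(k > i) g k]%O.
  have h0 : forall k, g k <= g i0.
    by rewrite /i0; case: arg_maxP => // i' _ hi' k; exact: hi'.
  by rewrite (h i0 h0 i) (h i0 h0 j).
move=> hmax j; apply/eqP; rewrite eq_le hmax /=.
pose G (z : state s0) := g i0 - g z.2.
have G0 z : 0 <= G z by rewrite subr_ge0.
have KG z : K G z <= 1 * G z.
  rewrite mul1r /G (kop_level (fun i => g i0 - g i)).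
  under eq_bigr do rewrite mulrBr.
  by rewrite sumrB -mulr_suml A_stoch mul1r hg.
have [n] := irr (0, i0) (0, j); rewrite pstepE => dn.
have := kit_super t_ge0 n (0, i0) ler01 KG.
move/(le_trans (@kit_ge1 _ _ _ _ t_ge0 n G (0, i0) (0, j) G0)).
by rewrite /G /= subrr mulr0 pmulr_lle0 // subr_le0.
Qed.

(** Fredholm alternative for [Asum A - 1]: harmonic vectors are constant, so by equality of row and
    column rank the left kernel is spanned by [pi]; the centred right-hand side is orthogonal to
    [pi], hence lies in the column space. *)
Lemma poisson_equation (b : 'I_s0 -> R) : exists g : 'I_s0 -> R, forall i,
  \sum_j Asum A i j * g j + b i = g i + \sum_j pi 0 j * b j.
Proof.
pose N := Asum A - 1%:M; pose D := \sum_j pi 0 j * b j.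
pose y : 'cV[R]_s0 := \col_i (D - b i).
have piN : pi *m N = 0 by rewrite mulmxBr mulmx1 pi_stat subrr.
have piy : pi *m y = 0.
  apply/matrixP => i j; rewrite (ord1 i) !mxE.
  under eq_bigr do rewrite !mxE mulrBr.
  by rewrite sumrB -mulr_suml pi_sum mul1r subrr.
have pi0 : pi != 0.
  apply/eqP => pi0; move: pi_sum; rewrite pi0.
  by under eq_bigr do rewrite mxE; rewrite big1 // => /eqP; rewrite eq_sym oner_eq0.
have kerNT : (kermx N^T <= (const_mx 1 : 'rV[R]_s0))%MS.
  apply/row_subP => r.
  have : row r (kermx N^T) *m N^T = 0 by rewrite -row_mul mulmx_ker row0.
  move: (row r _) => v vN.
  have hv i j : v 0 i = v 0 j.
    apply: (harmonic_const (g := fun i => v 0 i)) => {}i.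
    have /matrixP/(_ 0 i) := vN; rewrite !mxE.
    under eq_bigr do rewrite !mxE mulrBr mulrC mulr_natr mulrb.
    rewrite sumrB; under [X in _ - X]eq_bigr do rewrite eq_sym.
    by rewrite -big_mkcond big_pred1_eq => /eqP; rewrite subr_eq0 => /eqP.
  have [i0] : exists i : 'I_s0, True.
    move/eqP: pi0 => pi0; apply: contrapT => hno; apply: pi0.
    by apply/rowP => i; case: hno; exists i.
  move=> _; apply/sub_rVP; exists (v 0 i0); apply/rowP => i.
  by rewrite !mxE mulr1.
have rk : (\rank (kermx N) <= 1)%N.
  rewrite mxrank_ker; have := mxrankS kerNT.
  rewrite mxrank_ker mxrank_tr => /leq_trans; apply; exact: rank_leq_row.
have kerN : (kermx N <= pi)%MS.
  have le : (pi <= kermx N)%MS by apply/sub_kermxP.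
  have := mxrank_leqif_sup le; rewrite rank_rV pi0 => -[h1 h2].
  by rewrite -h2 eqn_leq h1.
have : (y^T <= N^T)%MS.
  rewrite submxE; set C := cokermx _.
  have : (C^T <= kermx N)%MS.
    by apply/sub_kermxP; rewrite -[N]trmxK -trmx_mul mulmx_coker trmx0.
  move=> /submx_trans/(_ kerN)/submxP[X hX].
  by rewrite -[C]trmxK hX trmx_mul mulmxA -trmx_mul piy trmx0 mul0mx.
move=> /submxP[X hX]; exists (fun i => X 0 i) => i.
have /matrixP/(_ 0 i) := hX; rewrite !mxE.
under eq_bigr do rewrite !mxE mulrBr mulrC mulr_natr mulrb.
rewrite sumrB; under [X in _ = _ - X]eq_bigr do rewrite eq_sym.
by rewrite -big_mkcond big_pred1_eq -/D; lra.
Qed.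

Definition drift (d : R * R) : R :=
  \sum_i pi 0 i * K (fun z => dot d z.1) (0, i).

(* To first order in [e], the vector [1 + e g], with [g] solving the Poisson
   equation, is multiplied by [1 + e * drift d] when tilting by [e d]. *)
Lemma Gamma_of_drift (d : R * R) :
  (forall k l, k \in steps -> l \in steps -> `|dot d (k, l)| <= 1) ->
  drift d < 0 -> exists th, Gamma A th.
Proof.
move=> d1 hd; set D := drift d in hd *.
have [g hg] := poisson_equation (fun i => K (fun z => dot d z.1) (0, i)).
pose G := \sum_i `|g i|.
have gG i : `|g i| <= G by exact: (@sum_ord_le _ _ (fun i => `|g i|)).
have G0 : 0 <= G by rewrite sumr_ge0.
(* [C] bounds the second-order coefficient [x g_j + 2 x^2 (1 + e g_j)] for [|x| <= 1]; the two
   bounds on [e] keep [1 + e g] positive and make [e^2 C] smaller than [- e D]. *)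
pose C := 5 * (1 + G).
have C0 : 0 < C by rewrite /C; lra.
pose e := Num.min (1 / (2 * (1 + G))) (- D / (2 * C)).
have e0 : 0 < e.
  rewrite lt_min !divr_gt0 ?oppr_gt0 ?mulr_gt0 //; lra.
have eG : e * (2 * (1 + G)) <= 1.
  by rewrite -ler_pdivlMr ?ge_min ?lexx //; lra.
have eC : e * C < - D.
  have : e * (2 * C) <= - D by rewrite -ler_pdivlMr ?ge_min ?lexx ?orbT //; lra.
  by have := mulr_gt0 e0 C0; lra.
have e2 : e <= 1 / 2 by nra.
pose th := (e * d.1, e * d.2).
have eg i : 0 < 1 + e * g i.
  have : - (e * g i) <= e * G.
    by rewrite -mulrN ler_wpM2l ?(ltW e0) // (le_trans _ (gG i)) // -normrN ler_norm.
  by nra.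
exists th; apply/(GammaP A_ge0); exists (fun i => 1 + e * g i); split=> // i.
pose F (r : bool) : state s0 -> R := if r then fun z => 1 else
  fun z => dot d z.1 + g z.2.
apply: (@le_lt_trans _ _ (K (fun z => \sum_(r <- [:: true; false])
     (if r then 1 + e ^+ 2 * C else e) * F r z) (0, i))).
  rewrite /kop big_seq [leRHS]big_seq; apply: ler_sum => z /succsP[k [l [j [hk hl ->]]]].
  rewrite ler_wpM2l ?t_ge0 // /tilt !big_cons big_nil /F /= add0r mulr1 addr0.
  set x := dot d (k, l); have x1 : `|x| <= 1 by exact: d1.
  have -> : ew th (k, l) = expR (e * x) by rewrite /ew /th /x /dot /=; congr expR; ring.
  have [xl xr] : -1 <= x /\ x <= 1 by apply/andP; rewrite -ler_norml.
  have [gl gr] : - G <= g j /\ g j <= G by apply/andP; rewrite -ler_norml.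
  have ex : e * x <= 1 / 2 by nra.
  apply: (@le_trans _ _ ((1 + e * x + 2 * (e * x) ^+ 2) * (1 + e * g j))).
    by rewrite ler_pM2r //; exact: expR_le_quadratic.
  rewrite -subr_ge0.
  have -> : 1 + e ^+ 2 * C + e * (x + g j) - (1 + e * x + 2 * (e * x) ^+ 2) * (1 + e * g j)
     = e ^+ 2 * (C - x * g j - 2 * x ^+ 2 * (1 + e * g j)) by ring.
  apply: mulr_ge0; first exact: sqr_ge0.
  have h1 : x * g j <= G.
    by rewrite (le_trans (ler_norm _)) // normrM -[G]mul1r ler_pM.
  have h2 : x ^+ 2 <= 1 by rewrite -real_normK ?num_real // expr_le1.
  have h3 : 1 + e * g j <= 1 + G by nra.
  have h4 : x ^+ 2 * (1 + e * g j) <= 1 + G.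
    by rewrite -[leRHS]mul1r ler_pM ?sqr_ge0 // ltW.
  by rewrite /C; lra.
have := @kit_sum _ _ (@succs s0) (trans A) 1 _ [:: true; false]
  (fun r : bool => if r then 1 + e ^+ 2 * C else e) F (0, i).
rewrite /kit /= => ->; rewrite !big_cons big_nil addr0 /F /=.
have -> : K (fun=> 1) (0, i) = 1.
  rewrite (kop_level (fun=> 1)) /=.
  by under eq_bigr do rewrite mulr1; rewrite A_stoch.
have -> : K (fun z => dot d z.1 + g z.2) (0, i) = g i + D.
  rewrite /D /drift -hg -(kop_level g (0, i)) addrC /kop -big_split /=.
  by apply: eq_bigr => z _; rewrite mulrDr addrC.
by rewrite mulr1 expr2; nra.
Qed.

End Poisson.

Lemma Gamma_nonempty (R : realType) (s0 : nat) (A : int -> int -> 'M[R]_s0)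
  (pi : 'rV[R]_s0)
  (A_ge0 : forall k l i j, 0 <= A k l i j)
  (A_stoch : forall i, \sum_(j < s0) Asum A i j = 1)
  (irr : irreducible_chain A)
  (pi_sum : \sum_(j < s0) pi 0 j = 1)
  (pi_stat : pi *m Asum A = pi)
  (hdrift : drift1 A pi < 0 \/ drift2 A pi < 0) : exists th, Gamma A th.
Proof.
case: hdrift => hd.
  apply: (@Gamma_of_drift _ _ A pi A_ge0 A_stoch irr pi_sum pi_stat (1, 0)).
    move=> k l; rewrite /dot /= mulr0 addr0 mulr1 !inE => /or3P[] /eqP -> _;
    by rewrite ?normrN ?normr1 ?normr0.
  suff -> : drift A pi (1, 0) = drift1 A pi by [].
  rewrite /drift1 mxE; under [RHS]eq_bigr do rewrite mxE mulr_suml.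
  rewrite [RHS]exchange_big /=; apply: eq_bigr => i _.
  under [RHS]eq_bigr do rewrite mxE mulr1.
  rewrite -mulr_sumr; congr (_ * _); rewrite stepE.
  under [RHS]eq_bigr do rewrite summxE.
  rewrite exchange_big [RHS]exchange_big /=; apply: eq_bigr => l _.
  rewrite !big_cons big_nil /dot /= !addr0 -!big_split /=; apply: eq_bigr => j _.
  by rewrite !mxE !add0r rmorphN rmorph1 /=; ring.
apply: (@Gamma_of_drift _ _ A pi A_ge0 A_stoch irr pi_sum pi_stat (0, 1)).
  move=> k l; rewrite /dot /= mulr0 add0r mulr1 !inE => _ /or3P[] /eqP ->;
  by rewrite ?normrN ?normr1 ?normr0.
suff -> : drift A pi (0, 1) = drift2 A pi by [].
rewrite /drift2 mxE; under [RHS]eq_bigr do rewrite mxE mulr_suml.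
rewrite [RHS]exchange_big /=; apply: eq_bigr => i _.
under [RHS]eq_bigr do rewrite mxE mulr1.
rewrite -mulr_sumr; congr (_ * _); rewrite stepE.
under [RHS]eq_bigr do rewrite summxE.
rewrite [RHS]exchange_big /=; apply: eq_bigr => k _.
rewrite !big_cons big_nil /dot /= !addr0 -!big_split /=; apply: eq_bigr => j _.
by rewrite !mxE !add0r rmorphN rmorph1 /=; ring.
Qed.

(** * Exponential moments of lattice weights *)

Definition irange (n : nat) : seq int := [seq i%:Z - n%:Z | i <- iota 0 (2 * n).+1].
Definition box (n : nat) : seq (int * int) := [seq (x, y) | x <- irange n, y <- irange n].

Lemma mem_irange n (x : int) : (x \in irange n) = (- n%:Z <= x <= n%:Z).
Proof.
apply/mapP/idP => [[a]|h]; first by rewrite mem_iota => ha ->; lia.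
by exists (absz (x + n%:Z)); [rewrite mem_iota; lia | lia].
Qed.

Lemma mem_box n (u : int * int) :
  (u \in box n) = (- n%:Z <= u.1 <= n%:Z) && (- n%:Z <= u.2 <= n%:Z).
Proof.
rewrite -!mem_irange; apply/idP/andP => [h|[h1 h2]].
  by case: (allpairsPdep h) => x [y [hx hy ->]].
by case: u h1 h2 => x y /= h1 h2; exact: allpairs_f.
Qed.

Lemma uniq_box n : uniq (box n).
Proof.
have uir : uniq (irange n).
  by rewrite map_inj_uniq ?iota_uniq // => a b /= h; lia.
by apply: allpairs_uniq => // -[a b] [a' b'].
Qed.

Lemma size_box n : size (box n) = ((2 * n).+1 ^ 2)%N.
Proof. by rewrite size_allpairs /irange size_map size_iota. Qed.

Section LatticeWeights.
Import numFieldNormedType.Exports.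
Variables (R : realType) (s : seq (int * int)) (mu : int * int -> R).
Hypothesis mu_ge0 : forall u, 0 <= mu u.

Definition mgf (th : R * R) : R := \sum_(u <- s) mu u * ew th u.

Lemma ewDl (th d : R * R) u : ew (th.1 + d.1, th.2 + d.2) u = ew th u * ew d u.
Proof. by rewrite /ew -expRD /dot /= !mulrDr addrACA. Qed.

Lemma mgf_tangent (th d : R * R) :
  mgf th + d.1 * (\sum_(u <- s) mu u * ew th u * u.1%:~R)
         + d.2 * (\sum_(u <- s) mu u * ew th u * u.2%:~R)
  <= mgf (th.1 + d.1, th.2 + d.2).
Proof.
rewrite /mgf !mulr_sumr -!big_split /=; apply: ler_sum => u _.
rewrite ewDl [leRHS]mulrA.
apply: (@le_trans _ _ (mu u * ew th u * (1 + dot d u))).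
  by rewrite le_eqVlt; apply/orP; left; apply/eqP; rewrite /dot; ring.
by rewrite ler_wpM2l ?mulr_ge0 // ?(ltW (ew_gt0 _ _)) // expR_ge1Dx.
Qed.

Lemma mgf_quadratic (th d : R * R) : exists2 Q, 0 <= Q & exists2 e0, 0 < e0 &
  forall e, 0 < e <= e0 ->
  mgf (th.1 + e * d.1, th.2 + e * d.2) <= mgf th
    + e * (d.1 * (\sum_(u <- s) mu u * ew th u * u.1%:~R)
         + d.2 * (\sum_(u <- s) mu u * ew th u * u.2%:~R)) + e ^+ 2 * Q.
Proof.
exists (\sum_(u <- s) mu u * ew th u * (2 * dot d u ^+ 2)).
  apply: sumr_ge0 => u _; apply: mulr_ge0; last by rewrite mulr_ge0 ?sqr_ge0.
  by rewrite mulr_ge0 // ltW // ew_gt0.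
pose B := \sum_(u <- s) `|dot d u|; have B0 : 0 <= B by rewrite sumr_ge0.
(* Up to this size [e |<d,u>| <= 1/2] for every [u] in [s], as [expR_le_quadratic] requires. *)
exists (1 / (2 * (1 + B))); first by rewrite divr_gt0 // mulr_gt0 //; lra.
move=> e /andP[e_gt0]; rewrite ler_pdivlMr => [he|]; last by lra.
rewrite mulrDr !mulr_sumr /mgf -!big_split /=.
rewrite big_seq [leRHS]big_seq; apply: ler_sum => u us.
have dB : `|dot d u| <= B.
  by rewrite /B (big_rem u) //= lerDl sumr_ge0.
rewrite (ewDl th (e * d.1, e * d.2)) [leLHS]mulrA.
apply: (@le_trans _ _ (mu u * ew th u * (1 + e * dot d u + 2 * (e * dot d u) ^+ 2))).
  rewrite ler_wpM2l ?mulr_ge0 // ?(ltW (ew_gt0 _ _)) //.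
  have -> : ew (e * d.1, e * d.2) u = expR (e * dot d u).
    by rewrite /ew /dot /=; congr expR; ring.
  apply: expR_le_quadratic.
  apply: (@le_trans _ _ (e * B)); last by nra.
  by rewrite ler_wpM2l ?(ltW e_gt0) // (le_trans (ler_norm _)).
by rewrite le_eqVlt; apply/orP; left; apply/eqP; rewrite /dot; ring.
Qed.

(** Moving from the maximizer along any [d] with [<c,d> > 0] leaves the sublevel set, so
    [mgf_quadratic] forces [<d,grad> >= 0] there, and the gradient is a nonnegative multiple of [c].
    A value [mgf th < 1] would leave room to move along [c]. A zero multiplier would make
    [mgf th = 1] a global minimum by [mgf_tangent], against [mgf th0 < 1]. *)
Lemma lagrange_multiplier (c1 c2 : R) (th th0 : R * R) : 0 < c1 -> 0 < c2 ->
  mgf th <= 1 -> mgf th0 < 1 ->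
  (forall th', mgf th' <= 1 -> c1 * th'.1 + c2 * th'.2 <= c1 * th.1 + c2 * th.2) ->
  mgf th = 1 /\ exists2 lam, 0 < lam &
    \sum_(u <- s) mu u * ew th u * u.1%:~R = lam * c1 /\
    \sum_(u <- s) mu u * ew th u * u.2%:~R = lam * c2.
Proof.
move=> c10 c20 hth hth0 hmax.
set g1 := \sum_(u <- s) mu u * ew th u * u.1%:~R.
set g2 := \sum_(u <- s) mu u * ew th u * u.2%:~R.
have key (d : R * R) : 0 < c1 * d.1 + c2 * d.2 ->
    exists2 Q, 0 <= Q & exists2 e0, 0 < e0 & forall e, 0 < e <= e0 ->
      1 < mgf th + e * (d.1 * g1 + d.2 * g2) + e ^+ 2 * Q.
  move=> cd; have [Q Q0 [e0 e00 he]] := mgf_quadratic th d.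
  exists Q => //; exists e0 => // e hee; apply: lt_le_trans (he e hee).
  rewrite ltNge; apply/negP => /hmax /=; have /andP[e_gt0 _] := hee.
  by have := mulr_gt0 e_gt0 cd; lra.
have g_ge0 (d : R * R) : 0 < c1 * d.1 + c2 * d.2 -> 0 <= d.1 * g1 + d.2 * g2.
  move=> cd; have [Q Q0 [e0 e00 he]] := key d cd.
  rewrite leNgt; apply/negP => hneg; set h := _ + _ in hneg he.
  pose e := Num.min e0 (- h / (1 + Q)).
  have e_gt0 : 0 < e by rewrite lt_min e00 divr_gt0 ?oppr_gt0 //; lra.
  have := he e; rewrite e_gt0 ge_min lexx => /(_ isT).
  have : e * (1 + Q) <= - h by rewrite -ler_pdivlMr ?ge_min ?lexx ?orbT //; lra.
  move=> h1 h2; have h3 : e * h + e ^+ 2 * Q <= 0.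
    have -> : e * h + e ^+ 2 * Q = e * (h + e * Q) by ring.
    by rewrite pmulr_rle0 //; nra.
  by lra.
have mgf1 : mgf th = 1.
  apply/eqP; rewrite eq_le hth /= leNgt; apply/negP => hlt.
  have [|Q Q0 [e0 e00 he]] := key (c1, c2); first by rewrite /=; nra.
  set h := _ + _ in he; pose C := 1 + `|h| + Q.
  have C0 : 0 < C by rewrite /C -addrA ltr_wpDr // addr_ge0.
  pose e := Num.min e0 (Num.min 1 ((1 - mgf th) / C)).
  have e_gt0 : 0 < e by rewrite !lt_min e00 ltr01 divr_gt0 // subr_gt0.
  have := he e; rewrite e_gt0 ge_min lexx => /(_ isT).
  have : e * C <= 1 - mgf th.
    by rewrite -ler_pdivlMr // !ge_min lexx !orbT.
  have e1 : e <= 1 by rewrite !ge_min lexx !orbT.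
  have hh : h <= `|h| := ler_norm h.
  have : e * h <= e * `|h| by rewrite ler_pM2l.
  have : e ^+ 2 * Q <= e * Q.
    by rewrite ler_wpM2r // expr2 ger_pMl.
  by rewrite /C => i1 i2 i3 i4; nra.
split=> //.
have eps (x y : R) : (forall e, 0 < e -> 0 <= x + e * y) -> 0 <= x.
  move=> h; rewrite leNgt; apply/negP => x0.
  have := h (- x / (1 + `|y|)); have y0 : 0 < 1 + `|y| by rewrite ltr_wpDr.
  rewrite divr_gt0 ?oppr_gt0 // => /(_ isT).
  have : - x / (1 + `|y|) * (1 + `|y|) = - x by rewrite divfK // gt_eqF.
  set e := - x / _ => ee; have e_gt0 : 0 < e by rewrite divr_gt0 ?oppr_gt0.
  have := ler_norm y; nra.
(* Test the two directions orthogonal to [c], tilted towards [c] by [e], and let [e] tend to 0. *)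
have ort : g1 * c2 = g2 * c1.
  apply/eqP; rewrite eq_le; apply/andP; split; rewrite -subr_ge0.
    apply: (@eps _ (c1 * g1 + c2 * g2)) => e e0.
    have := g_ge0 (- c2 + e * c1, c1 + e * c2); rewrite /=.
    have -> : c1 * (- c2 + e * c1) + c2 * (c1 + e * c2) = e * (c1 ^+ 2 + c2 ^+ 2) by ring.
    rewrite mulr_gt0 ?addr_gt0 ?exprn_gt0 // => /(_ isT); lra.
  apply: (@eps _ (c1 * g1 + c2 * g2)) => e e0.
  have := g_ge0 (c2 + e * c1, - c1 + e * c2); rewrite /=.
  have -> : c1 * (c2 + e * c1) + c2 * (- c1 + e * c2) = e * (c1 ^+ 2 + c2 ^+ 2) by ring.
  rewrite mulr_gt0 ?addr_gt0 ?exprn_gt0 // => /(_ isT); lra.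
pose lam := g1 / c1.
have g1E : g1 = lam * c1 by rewrite divfK // gt_eqF.
have g2E : g2 = lam * c2.
  by rewrite /lam mulrAC ort mulfK // gt_eqF.
have c2sum : 0 < c1 ^+ 2 + c2 ^+ 2 by rewrite addr_gt0 ?exprn_gt0.
have lam0 : 0 <= lam.
  have := g_ge0 (c1, c2); rewrite /= -!expr2 => /(_ c2sum).
  have -> : c1 * g1 + c2 * g2 = lam * (c1 ^+ 2 + c2 ^+ 2) by rewrite g1E g2E; ring.
  by rewrite pmulr_lge0.
exists lam => //; rewrite lt_neqAle lam0 andbT; apply/eqP => lz.
have := mgf_tangent th (th0.1 - th.1, th0.2 - th.2); rewrite /= -/g1 -/g2.
rewrite g1E g2E -lz !mul0r !mulr0 !addr0 mgf1 !subrKC -surjective_pairing.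
by rewrite leNgt hth0.
Qed.

Lemma mgf_continuous : continuous (mgf : R * R -> R).
Proof.
move=> th; rewrite /mgf.
apply: (@cvg_big _ _ _ _ _ (@add_continuous R)) => // u _.
apply: cvgM; first exact: cvg_cst.
apply: continuous_comp; last exact: continuous_expR.
apply: cvgD; apply: cvgM; try exact: cvg_cst.
  exact: cvg_fst.
exact: cvg_snd.
Qed.

End LatticeWeights.

(** * The optimal tilt *)

Section OptimalTilt.
Import numFieldNormedType.Exports.
Variables (R : realType) (s0 : nat) (A : int -> int -> 'M[R]_s0).
Hypothesis A_ge0 : forall k l i j, 0 <= A k l i j.
Hypothesis irr : irreducible_chain A.
Variable j : 'I_s0.

Local Notation K := (kop (@succs s0) (trans A)).
Local Notation Kit := (kit (@succs s0) (trans A)).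
Let t_ge0 := trans_ge0 A_ge0.

Definition loop_weight (n : nat) (u : int * int) : R := pstep A n (0, j) (u, j).

Lemma loop_weight_ge0 n u : 0 <= loop_weight n u.
Proof.
by rewrite /loop_weight pstepE; apply: (kit_ge0 _ t_ge0) => z; exact: dirac_at_ge0.
Qed.

Lemma confined_succs (L : pred (state s0)) n y :
  (forall z, z.1 - y.1 \in box n -> L z) -> confined (@succs s0) L n y.
Proof.
elim: n y => [|n IH] y h; first by apply: h; rewrite subrr mem_box.
move=> z /succsP[k [l [i [hk hl ->]]]]; apply: IH => w hw; apply: h.
move: hk hl hw; rewrite !mem_box /steps !inE /=; lia.
Qed.

(** Loops of length [n] move at most [n] in each coordinate, so the diagonal entry is a finite
    exponential sum. *)
Lemma phi_mgf n th : phi A j n th = mgf (box n) (loop_weight n) th.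
Proof.
pose L : seq (state s0) := [seq (u, j) | u <- box n].
have uL : uniq L by rewrite map_inj_uniq ?uniq_box // => a b [].
pose F : state s0 -> R := fun z => ew th z.1.
rewrite /phi (@kit_eq_confined _ _ _ _ [pred z | z.1 \in box n] n _
   (fun z => \sum_(t <- L) F t * dirac_at R t z)).
- rewrite kit_sum /L big_map; apply: eq_bigr => u _.
  by rewrite /loop_weight pstepE mulrC.
- by apply: confined_succs => z; rewrite subr0.
move=> [x i] /= hx; rewrite dirac_at_sum // /tilt /=.
have -> : ((x, i) \in L) = (i == j).
  apply/mapP/eqP => [[u _ [_ //]]|->]; by exists x.
by case: eqP => _; rewrite ?mulr1 ?mulr0.
Qed.

Lemma phi_continuous n : continuous (phi A j n : R * R -> R).
Proof.
have -> : phi A j n = mgf (box n) (loop_weight n) by apply/funext => th; exact: phi_mgf.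
exact: mgf_continuous.
Qed.

(** [m!] is a multiple of every [n] with [0 < n <= m], and exceeding 1 passes to multiples by
    [phi_exp]. Along factorials, different loop lengths can thus be merged by taking [m] large. *)
Lemma phi_fact_gt1 (n m : nat) th : (0 < n)%N -> (n <= m)%N -> 1 < phi A j n th ->
  1 < phi A j m`! th.
Proof.
move=> n0 nm h.
have dv : (n %| m`!)%N by apply: dvdn_fact; rewrite n0.
rewrite -(divnK dv); apply: lt_le_trans (phi_exp A_ge0 _ _ _ _).
by rewrite exprn_egt1 // -lt0n divn_gt0 // dvdn_leq // fact_gt0.
Qed.

Lemma phi0 th : phi A j 0 th = 1.
Proof. by rewrite /phi /kit /= /tilt ew0 eqxx mulr1. Qed.

(** Passages from [j] at the origin to [j] at [u] have some total weight [d > 0] and contribute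
    [d e^<th,u>], which exceeds 1 once [<th,u> > -ln d]. *)
Lemma phi_gt1_direction (u : int * int) : exists n B, forall th,
  B < dot th u -> 1 < phi A j n th.
Proof.
have [n hn] := irr (0, j) (u, j); rewrite pstepE in hn; exists n.
set d := Kit n _ _ in hn; exists (- ln d) => th hB.
apply: lt_le_trans (@kit_ge1 _ _ _ _ t_ge0 n _ (0, j) (u, j) _).
  rewrite /tilt /= eqxx mulr1 -/d -[X in _ * X](lnK hn) /ew -expRD.
  by rewrite -expR0 ltr_expR; lra.
by move=> z; exact: tilt_ge0.
Qed.

Lemma phi_gt1_pos n th : 1 < phi A j n th -> (0 < n)%N.
Proof. by case: n => //; rewrite phi0 ltxx. Qed.

(** Loops displaced along the four unit vectors confine the sublevel sets to one square, common to
    all large [m]. *)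
Lemma phi_gt1_far : exists n0 B, forall m th, (n0 <= m)%N ->
  phi A j m`! th <= 1 -> `|th.1| <= B /\ `|th.2| <= B.
Proof.
have [n1 [B1 h1]] := phi_gt1_direction (1, 0).
have [n2 [B2 h2]] := phi_gt1_direction (-1, 0).
have [n3 [B3 h3]] := phi_gt1_direction (0, 1).
have [n4 [B4 h4]] := phi_gt1_direction (0, -1).
exists (n1 + n2 + n3 + n4)%N, (`|B1| + `|B2| + `|B3| + `|B4|) => m th hm hphi.
have aux n B u : (n <= m)%N -> (forall th, B < dot th u -> 1 < phi A j n th) ->
    dot th u <= B.
  move=> nm h; rewrite leNgt; apply/negP => /h hgt.
  by have := phi_fact_gt1 (phi_gt1_pos hgt) nm hgt; rewrite ltNge hphi.
have a1 : th.1 <= B1.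
  by have := aux n1 B1 _ _ h1; rewrite /dot /= mul1r mul0r addr0; apply; lia.
have a2 : - th.1 <= B2.
  by have := aux n2 B2 _ _ h2; rewrite /dot /= mulN1r mul0r addr0; apply; lia.
have a3 : th.2 <= B3.
  by have := aux n3 B3 _ _ h3; rewrite /dot /= mul1r mul0r add0r; apply; lia.
have a4 : - th.2 <= B4.
  by have := aux n4 B4 _ _ h4; rewrite /dot /= mulN1r mul0r add0r; apply; lia.
have := (ler_norm B1, ler_norm B2, ler_norm B3, ler_norm B4).
have := (normr_ge0 B1, normr_ge0 B2, normr_ge0 B3, normr_ge0 B4).
by move=> [[[p1 p2] p3] p4] [[[q1 q2] q3] q4]; split; rewrite ler_norml; apply/andP; split; lra.
Qed.

Variables (c1 c2 : R).
Hypotheses (c1_gt0 : 0 < c1) (c2_gt0 : 0 < c2).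

Lemma linear_form_continuous : continuous (fun th : R * R => c1 * th.1 + c2 * th.2 : R).
Proof.
move=> th; apply: cvgD; apply: cvgM; try exact: cvg_cst.
  exact: cvg_fst.
exact: cvg_snd.
Qed.

Variables (th0 : R * R) (s g : R).
Hypothesis G0 : Gamma A th0.
Hypothesis Gs : forall th, Gamma A th -> c1 * th.1 + c2 * th.2 <= s.
Hypothesis sg : s < g.

(** Otherwise [Gamma_segment] puts in [Gamma] a point between [th] and [th0] at which the linear
    form still exceeds [s]. *)
Lemma phi_gt1_beyond th : g <= c1 * th.1 + c2 * th.2 -> exists n, 1 < phi A j n th.
Proof.
move=> hth; apply: contrapT => hno.
have h1 n : phi A j n th <= 1 by rewrite leNgt; apply/negP => h; apply: hno; exists n.
set a := c1 * th.1 + c2 * th.2 in hth; pose b := c1 * th0.1 + c2 * th0.2.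
have bs : b <= s by exact: Gs.
have ab : 0 < a - b by rewrite subr_gt0 (le_lt_trans bs) // (lt_le_trans sg).
(* This [t] makes the value at the interpolated point the midpoint of [a] and [s]. *)
pose t := (a - s) / (2 * (a - b)).
have t0 : 0 < t by rewrite divr_gt0 ?mulr_gt0 // subr_gt0 (lt_le_trans sg).
have t1 : t < 1.
  rewrite ltr_pdivrMr ?mulr_gt0 // mul1r; move: ab bs; lra.
have := Gs (Gamma_segment A_ge0 irr (j := j) (t := t) (th := th) _ G0 h1).
rewrite t0 t1 => /(_ isT) /=.
have -> : c1 * ((1 - t) * th.1 + t * th0.1) + c2 * ((1 - t) * th.2 + t * th0.2) = a - t * (a - b).
  by rewrite /a /b; ring.
have -> : t * (a - b) = (a - s) / 2.
  by rewrite /t; field; exact: lt0r_neq0.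
by have := lt_le_trans sg hth; lra.
Qed.

(** Near each point of the square either the linear form stays below [g] or some [phi] stays above
    1; compactness and factorial lengths turn these local facts into a single loop length. *)
Lemma sublevel_bound : exists m B, (0 < m)%N /\ forall th, phi A j m th <= 1 ->
  [/\ `|th.1| <= B, `|th.2| <= B & c1 * th.1 + c2 * th.2 < g].
Proof.
have [n0 [B hB]] := phi_gt1_far.
have cK : compact (`[- B, B] `*` `[- B, B] : set (R * R)).
  by apply: compact_setX; exact: segment_compact.
pose P (m : nat) (th : R * R) := g <= c1 * th.1 + c2 * th.2 -> 1 < phi A j m`! th.
have /compact_near_coveringP/(_ _ \oo P _) := cK.
case=> [th _|n1 _ hn1].
  have [hth|hth] := ltP (c1 * th.1 + c2 * th.2) g.
    have : \forall th' \near th, c1 * th'.1 + c2 * th'.2 < g.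
      by apply: (cvgr_lt _ (@linear_form_continuous th)).
    move=> h; exists ([set th' | c1 * th'.1 + c2 * th'.2 < g], setT) => /=.
      by split => //; exact: filterT.
    by move=> [th' m] /= [h1 _]; rewrite /P leNgt h1.
  have [n hn] := phi_gt1_beyond hth.
  have : \forall th' \near th, 1 < phi A j n th'.
    by apply: (cvgr_gt _ (@phi_continuous n th)).
  move=> h; exists ([set th' | 1 < phi A j n th'], [set m | (n <= m)%N]) => /=.
    by split => //; exists n.
  by move=> [th' m] /= [h1 h2] _; exact: (phi_fact_gt1 (phi_gt1_pos h1) h2 h1).
pose m := maxn n0 n1; exists m`!, B; split; first exact: fact_gt0.
move=> th hth; have [b1 b2] := hB m th (leq_maxl _ _) hth; split => //.
rewrite ltNge; apply/negP => hg.
have := hn1 m (leq_maxr _ _) th _ hg; rewrite ltNge hth => /(_ _)/notF; apply.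
by split; rewrite /= in_itv /= -ler_norml.
Qed.

(** The sublevel set is compact, so the linear form attains its maximum on it; [th0] is the strictly
    feasible point needed by the multiplier rule. *)
Lemma optimal_tilt : exists m th lam, [/\ (0 < m)%N, c1 * th.1 + c2 * th.2 < g,
  0 < lam, mgf (box m) (loop_weight m) th = 1 &
  \sum_(u <- box m) loop_weight m u * ew th u * u.1%:~R = lam * c1 /\
  \sum_(u <- box m) loop_weight m u * ew th u * u.2%:~R = lam * c2].
Proof.
have [m [B [m0 hB]]] := sublevel_bound.
have [r /andP[r0 r1] hr] := phi_le_geometric A_ge0 G0.
have phi_th0 : phi A j m th0 < 1.
  by apply: (le_lt_trans (hr _ _)); rewrite exprn_ilt1 ?ltW // -lt0n.
pose S := (`[- B, B] `*` `[- B, B]) `&` (phi A j m @^-1` [set x : R | x <= 1]).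
have cS : compact (S : set (R * R)).
  apply: compact_closedI.
    by apply: compact_setX; exact: segment_compact.
  apply: closed_comp; last exact: closed_le.
  by move=> th _; exact: phi_continuous.
have S_in th : phi A j m th <= 1 -> S th.
  move=> h; have [b1 b2 _] := hB th h; split => //.
  by split; rewrite /= in_itv /= -ler_norml.
have [||th /set_mem[_ /= hth] hmax] :=
    @compact_EVT_max _ R (fun th : R * R => c1 * th.1 + c2 * th.2) _ _ cS.
- by exists th0; apply: S_in; exact: ltW.
- by apply: continuous_subspaceT; exact: linear_form_continuous.
have [|||h1 [lam lam0 hl]] := @lagrange_multiplier _ (box m) _ (loop_weight_ge0 m)
  c1 c2 th th0 c1_gt0 c2_gt0.
- by rewrite -phi_mgf.
- by rewrite -phi_mgf.
- by move=> th'; rewrite -phi_mgf => /S_in h; apply: hmax; rewrite inE.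
by exists m, th, lam; split => //; case: (hB th hth).
Qed.

End OptimalTilt.

(** * Chernoff bound *)

Section LatticeWalk.
Variables (R : realType) (M : nat) (mu : int * int -> R).
Hypothesis mu_ge0 : forall u, 0 <= mu u.

Definition walk_succs (v : int * int) : seq (int * int) := [seq v + u | u <- box M].
Definition walk_weight (v z : int * int) : R := mu (z - v).

Local Notation D := (kop walk_succs walk_weight).
Local Notation Walk := (kit walk_succs walk_weight).
Let w_ge0 v z : 0 <= walk_weight v z.
Proof. exact: mu_ge0. Qed.

Lemma walk_step F v : D F v = \sum_(u <- box M) mu u * F (v + u).
Proof.
by rewrite /kop big_map; apply: eq_bigr => u _; rewrite /walk_weight [v + u]addrC addrK.
Qed.

Lemma walk_ew n th v : Walk n (ew th) v = mgf (box M) mu th ^+ n * ew th v.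
Proof.
have m0 : 0 <= mgf (box M) mu th.
  by apply: sumr_ge0 => u _; rewrite mulr_ge0 // ltW // ew_gt0.
have h z : D (ew th) z = mgf (box M) mu th * ew th z.
  rewrite walk_step /mgf mulr_suml; apply: eq_bigr => u _.
  by rewrite ewD mulrCA mulrC mulrAC.
by apply/eqP; rewrite eq_le kit_super ?kit_sub // => z; rewrite h.
Qed.

Lemma confined_walk (L : pred (int * int)) n v :
  (forall z, z - v \in box (M * n) -> L z) -> confined walk_succs L n v.
Proof.
elim: n v => [|n IH] v h; first by apply: h; rewrite subrr mem_box muln0.
move=> z /mapP[u hu ->]; apply: IH => w hw; apply: h.
move: hu hw; rewrite !mem_box /= mulnS; lia.
Qed.

Variables (th : R * R) (m1 m2 : R).
Hypothesis mgf1 : mgf (box M) mu th = 1.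
Hypothesis mean1 : \sum_(u <- box M) mu u * ew th u * u.1%:~R = m1.
Hypothesis mean2 : \sum_(u <- box M) mu u * ew th u * u.2%:~R = m2.

(** Chernoff's method: the function inside [Walk] dominates [e^<th,v>] on the half-plane where
    [<d,v>] exceeds its tilted mean by [n eps], and for small [del] the linear gain [del eps] beats
    the quadratic error [del^2 Q]. *)
Lemma tail_bound (d : R * R) (eps : R) : 0 < eps ->
  exists del rho, [/\ 0 < del, 0 <= rho < 1 & forall n,
    Walk n (fun v => expR (- del * (n%:R * (d.1 * m1 + d.2 * m2 + eps)))
             * ew (th.1 + del * d.1, th.2 + del * d.2) v) 0 <= rho ^+ n].
Proof.
move=> eps0; have [Q Q0 [e0 e00 he]] := mgf_quadratic (box M) mu_ge0 th d.
rewrite mean1 mean2 mgf1 in he; set h := d.1 * m1 + d.2 * m2 in he *.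
pose del := Num.min e0 (eps / (2 * (1 + Q))).
have del0 : 0 < del by rewrite lt_min e00 divr_gt0 ?mulr_gt0 //; lra.
have delQ : del * (2 * (1 + Q)) <= eps.
  by rewrite -ler_pdivlMr ?ge_min ?lexx ?orbT //; lra.
exists del, (expR (- del * (eps / 2))); split=> //.
  rewrite expR_ge0 -expR0 ltr_expR mulNr oppr_lt0 mulr_gt0 ?divr_gt0 //.
move=> n; rewrite kitZ walk_ew ew0 mulr1.
have -> : - del * (n%:R * (h + eps)) = n%:R * (- del * (h + eps)) by ring.
rewrite expRM_natl -exprMn; apply: lerXn2r; rewrite ?nnegrE ?expR_ge0 //.
  rewrite mulr_ge0 ?expR_ge0 //.
  by apply: sumr_ge0 => u _; rewrite mulr_ge0 // ltW // ew_gt0.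
have hm := he del; rewrite del0 ge_min lexx in hm.
apply: (@le_trans _ _ (expR (- del * (h + eps)) * expR (del * h + del ^+ 2 * Q))).
  rewrite ler_wpM2l ?expR_ge0 //; apply: (le_trans (hm isT)).
  by rewrite -addrA expR_ge1Dx.
rewrite -expRD ler_expR.
have -> : - del * (h + eps) + (del * h + del ^+ 2 * Q) = del * (del * Q - eps) by ring.
by rewrite mulNr -mulrN ler_pM2l //; nra.
Qed.

(** The complement of the square around [N] times the mean is covered by four half-planes, each of
    tilted mass below 1/8, so the square keeps mass above 1/2; by pigeonhole one of its points
    carries at least 1/2 divided by the size of the box. *)
Lemma block_exists (eps : R) : 0 < eps -> exists N0, forall N, (N0 <= N)%N ->
  exists v, [/\ v \in box (M * N),
    `|v.1%:~R - N%:R * m1| <= N%:R * eps, `|v.2%:~R - N%:R * m2| <= N%:R * eps &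
    1 <= Walk N (dirac_at R v) 0 * ew th v * (2 * (size (box (M * N)))%:R)].
Proof.
move=> eps0.
have /choice[del /choice[rho hdr]]  := (fun d => @tail_bound d eps eps0).
pose dirs : seq (R * R) := [:: (1, 0); (-1, 0); (0, 1); (0, -1)].
have /choice[n0 hn0] : forall d, exists n0, forall n, (n0 <= n)%N -> rho d ^+ n < 1 / 8.
  move=> d; have [_ r01 _] := hdr d; have /andP[r0 r1] := r01.
  have [N _ hN] := @small_power _ (rho d) (1 / 8) 0 r01 (ltac:(lra)).
  exists N => n Nn; apply: le_lt_trans hN.
  by rewrite ler_wiXn2l // ltW.
exists (\sum_(d <- dirs) n0 d)%N => N hN.
pose good (v : int * int) := (`|v.1%:~R - N%:R * m1| <= N%:R * eps) &&
   (`|v.2%:~R - N%:R * m2| <= N%:R * eps).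
pose tail d v := expR (- del d * (N%:R * (d.1 * m1 + d.2 * m2 + eps)))
             * ew (th.1 + del d * d.1, th.2 + del d * d.2) v.
have tail0 d v : 0 <= tail d v by rewrite mulr_ge0 ?expR_ge0 // ltW // ew_gt0.
have tail_big d v : N%:R * (d.1 * m1 + d.2 * m2 + eps) <= dot d v -> ew th v <= tail d v.
  move=> h; have [del0 _ _] := hdr d.
  rewrite /tail (ewDl th (del d * d.1, del d * d.2)) mulrCA ler_pMr ?ew_gt0 //.
  rewrite /ew -expRD -[leLHS]expR0 ler_expR.
  have -> : dot (del d * d.1, del d * d.2) v = del d * dot d v by rewrite /dot /=; ring.
  by rewrite mulNr addrC subr_ge0 ler_pM2l.
(* [None] stands for the square, [Some d] for the half-plane in direction [d]. *)
pose F b v := if b is Some d then tail d v else (good v)%:R * ew th v.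
have cover v : ew th v <= \sum_(b <- None :: map Some dirs) 1 * F b v.
  rewrite !big_cons big_nil !mul1r /= addr0.
  have := (tail0 (1, 0) v, tail0 (-1, 0) v, tail0 (0, 1) v, tail0 (0, -1) v).
  move=> [[[p1 p2] p3] p4].
  case gv : (good v); first by rewrite mul1r; lra.
  rewrite mul0r add0r; move/negbT: gv; rewrite negb_and -!ltNge !ltr_normr.
  case/orP => /orP[] h.
  - have := @tail_big (1, 0) v; rewrite /dot /= => H.
    have := H (ltac:(lra)); lra.
  - have := @tail_big (-1, 0) v; rewrite /dot /= => H.
    have := H (ltac:(lra)); lra.
  - have := @tail_big (0, 1) v; rewrite /dot /= => H.
    have := H (ltac:(lra)); lra.
  - have := @tail_big (0, -1) v; rewrite /dot /= => H.
    have := H (ltac:(lra)); lra.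
have tail_small d : d \in dirs -> Walk N (tail d) 0 < 1 / 8.
  move=> hd; have [_ _ hw] := hdr d; apply: (le_lt_trans (hw N)).
  by apply: hn0; apply: leq_trans hN; rewrite (big_rem d) //= leq_addr.
have big : 1 / 2 < Walk N (fun v => (good v)%:R * ew th v) 0.
  have := kit_le walk_succs w_ge0 N 0 cover.
  rewrite walk_ew mgf1 expr1n ew0 mul1r kit_sum !big_cons big_nil !mul1r /= addr0.
  have t1 := @tail_small (1, 0) ltac:(by rewrite !inE eqxx ?orbT).
  have t2 := @tail_small (-1, 0) ltac:(by rewrite !inE eqxx ?orbT).
  have t3 := @tail_small (0, 1) ltac:(by rewrite !inE eqxx ?orbT).
  have t4 := @tail_small (0, -1) ltac:(by rewrite !inE eqxx ?orbT).
  rewrite /F; lra.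
apply: contrapT => hno; move: big; apply/negP; rewrite -leNgt.
rewrite (kit_eq_sum _ _ (uniq_box (M * N))); last first.
  by apply: confined_walk => z; rewrite subr0.
have S0 : 0 < 2 * (size (box (M * N)))%:R :> R by rewrite size_box mulr_gt0 // ltr0n expn_gt0.
apply: (@le_trans _ _ (\sum_(z <- box (M * N)) (2 * (size (box (M * N)))%:R)^-1)).
  rewrite big_seq [leRHS]big_seq; apply: ler_sum => v hv.
  case gv : (good v); last by rewrite !mul0r invr_ge0 ltW.
  rewrite mul1r -[leRHS]mul1r ler_pdivlMr //.
  rewrite leNgt; apply/negP => hgt; apply: hno; exists v.
  move/andP: gv => [g1 g2]; split => //.
  by rewrite [_ * ew th v]mulrC ltW.
rewrite big_const_seq count_predT iter_addr addr0 -[leLHS]mulr_natl.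
set c := (size _)%:R in S0 *; have c0 : c != 0 by apply/eqP => c0; rewrite c0 mulr0 ltxx in S0.
by rewrite le_eqVlt; apply/orP; left; apply/eqP; field.
Qed.

End LatticeWalk.

(** * The killed chain *)

Section KilledChain.
Variables (R : realType) (s0 : nat) (A : int -> int -> 'M[R]_s0).
Hypothesis A_ge0 : forall k l i j, 0 <= A k l i j.

Local Notation K := (kop (@succs s0) (trans A)).
Local Notation Kit := (kit (@succs s0) (trans A)).
Let t_ge0 := trans_ge0 A_ge0.

Definition ktrans (y z : state s0) : R := (inSplus y)%:R * trans A y z.
Local Notation KitP := (kit (@succs s0) ktrans).

Lemma ktrans_ge0 y z : 0 <= ktrans y z.
Proof. by rewrite mulr_ge0 ?ler0n. Qed.

Lemma pplusS n y y' : pplus A n.+1 y y' = (inSplus y)%:R * K (pplus A n ^~ y') y.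
Proof. by []. Qed.

Lemma pplusD m n x z : pplus A (m + n) x z = KitP m (pplus A n ^~ z) x.
Proof.
elim: m x => // m IH x; rewrite addSn pplusS kitS /kop mulr_sumr.
by apply: eq_bigr => y _; rewrite mulrA IH.
Qed.

Lemma pplusE n x y : inSplus y -> pplus A n x y = KitP n (dirac_at R y) x.
Proof.
move=> hy; rewrite -[n in LHS]addn0 pplusD; congr (kit _ _ _ _ _).
apply/funext => z; rewrite /dirac_at /=.
by case: eqP => [->|//]; rewrite hy.
Qed.

Lemma pplus_ge0 n x y : 0 <= pplus A n x y.
Proof.
rewrite -[n]addn0 pplusD; apply: (kit_ge0 _ ktrans_ge0) => z /=.
exact: ler0n.
Qed.

Lemma pplus_comp m n x y z : inSplus y ->
  pplus A m x y * pplus A n y z <= pplus A (m + n) x z.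
Proof.
move=> hy; rewrite (pplusE m x hy) pplusD mulrC.
apply: (@kit_ge1 _ _ _ _ ktrans_ge0 m (pplus A n ^~ z)) => t.
exact: pplus_ge0.
Qed.

(** A translation with nonnegative coordinates keeps every surviving path in the quadrant and may
    let more paths survive. *)
Lemma pplus_shift n (d : int * int) y y' : 0 <= d.1 -> 0 <= d.2 ->
  pplus A n y y' <= pplus A n (translate d y) (translate d y').
Proof.
move=> d1 d2.
have inS z : inSplus z -> inSplus (translate d z).
  by rewrite /inSplus /= => /andP[h1 h2]; rewrite !addr_ge0.
elim: n y => [|n IH] y.
  rewrite /=; case: eqP => [->|_]; last by rewrite ler0n.
  by rewrite eqxx /=; case: (boolP (inSplus y')) => [/inS -> //|_]; rewrite ler0n.
rewrite !pplusS; case: (boolP (inSplus y)) => [/inS ->|_]; last first.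
  rewrite mul0r mulr_ge0 ?ler0n //; apply: sumr_ge0 => z _.
  by rewrite mulr_ge0 // pplus_ge0.
rewrite !mul1r !stepE; apply: ler_sum => k _; apply: ler_sum => l _.
apply: ler_sum => i _; rewrite ler_wpM2l //.
by have := IH (y.1 + (k, l), i); rewrite /translate /= addrA.
Qed.

Lemma pstep_le_pplus n (y y' : state s0) : n%:Z <= y.1.1 -> n%:Z <= y.1.2 ->
  pstep A n y y' <= pplus A n y y'.
Proof.
elim: n y => [|n IH] y h1 h2.
  have hy : inSplus y by apply/andP; split; lia.
  by rewrite /= hy andbT.
have -> : pstep A n.+1 y y' = K (pstep A n ^~ y') y by [].
have hy : inSplus y by apply/andP; split; lia.
rewrite pplusS hy mul1r /kop big_seq [leRHS]big_seq.
apply: ler_sum => z /succsP[k [l [i [hk hl ->]]]].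
rewrite ler_wpM2l ?t_ge0 //; apply: IH; move: hk hl; rewrite /steps !inE /=; lia.
Qed.

(** Cut paths at the loop ends. From height [m N] in both coordinates, the height left before each
    loop covers all remaining steps, so nothing is killed on the way. *)
Lemma walk_le_pplus (j : 'I_s0) m N (x z : int * int) :
  (m * N)%:Z <= x.1 -> (m * N)%:Z <= x.2 ->
  kit (walk_succs m) (walk_weight (loop_weight A j m)) N (dirac_at R z) x
  <= pplus A (m * N) (x, j) (z, j).
Proof.
elim: N x => [|N IH] x h1 h2.
  have hx : inSplus (x, j) by apply/andP; split; rewrite /=; lia.
  by rewrite muln0 /= hx /dirac_at xpair_eqE eqxx !andbT.
rewrite kitS walk_step mulnS pplusD.
pose L : seq (state s0) := [seq (x + u, j) | u <- box m].
have uL : uniq L.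
  by rewrite map_inj_uniq ?uniq_box // => a b [] h3 h4; case: a b h3 h4 => [? ?] [? ?] /= h3 h4; congr pair; lia.
apply: le_trans (@kit_ge_sum _ _ _ _ ktrans_ge0 m L _ (x, j) uL _); last first.
  by move=> t; exact: pplus_ge0.
rewrite /L big_map big_seq [leRHS]big_seq; apply: ler_sum => u.
rewrite mem_box mulrC => hu.
have hx1 : (m * N)%:Z <= (x + u).1 by rewrite /=; lia.
have hx2 : (m * N)%:Z <= (x + u).2 by rewrite /=; lia.
apply: ler_pM.
- apply: kit_ge0 => *; [exact: loop_weight_ge0 | exact: dirac_at_ge0].
- exact: loop_weight_ge0.
- exact: IH.
rewrite -pplusE; last by apply/andP; split; move: hx1 hx2; rewrite /=; lia.
apply: le_trans (pstep_le_pplus _ _ _); rewrite /=; [|lia|lia].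
rewrite /loop_weight !pstepE.
have -> : dirac_at R (u, j) = dirac_at R (x + u, j) \o translate x.
  apply/funext => -[t i]; rewrite /dirac_at /comp /translate.
  congr (nat_of_bool _)%:R; apply/eqP/eqP => [[-> ->] //|h].
  have [e1 e2] := (congr1 fst h, congr1 snd h).
  by congr pair; [exact: addrI e1 | exact: e2].
by rewrite Kit_shift /translate /= addr0.
Qed.

Lemma qtilde_ge n y y' : ((pplus A n y y')%:E <= qtilde A y y')%E.
Proof.
rewrite /qtilde; apply: (@le_trans _ _ (\sum_(0 <= i < n.+1) (pplus A i y y')%:E)%E).
  rewrite big_nat_recr //= leeDr // sume_ge0 // => i _.
  by rewrite lee_fin pplus_ge0.
by apply: nneseries_lim_ge => i _ _; rewrite lee_fin pplus_ge0.
Qed.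

(** Killing only discards nonnegative terms, so the contraction of the free chain is inherited. *)
Lemma pplus_contraction th v r n y y' :
  0 <= r -> (forall i, 0 < v i) ->
  (forall z, K (tilt th v) z <= r * tilt th v z) ->
  pplus A n y y' * tilt th v y' <= r ^+ n * tilt th v y.
Proof.
move=> r0 v0 hK.
have h0 z : 0 < tilt th v z by rewrite mulr_gt0 ?ew_gt0.
elim: n y => [|n IH] y.
  rewrite expr0 mul1r /=; case: eqP => [->|_]; last by rewrite mul0r ltW.
  by rewrite ger_pMl ?h0 // lern1; case: (inSplus _).
pose c := tilt th v y'.
have -> : pplus A n.+1 y y' * c = (inSplus y)%:R * K (fun z => c * pplus A n z y') y.
  rewrite pplusS -mulrA [K _ _ * c]mulrC; congr (_ * _).
  exact: esym (kitZ _ _ 1 c (pplus A n ^~ y') y).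
apply: (@le_trans _ _ (K (fun z => r ^+ n * tilt th v z) y)).
  rewrite -[leRHS]mul1r; apply: ler_pM; rewrite ?ler0n ?lern1 //.
  - apply: sumr_ge0 => z _; rewrite mulr_ge0 // mulr_ge0 ?pplus_ge0 //.
    exact: ltW (h0 _).
  - by case: (inSplus _).
  - by apply: (kop_le _ t_ge0) => z; rewrite mulrC.
have := kitZ (@succs s0) (trans A) 1 (r ^+ n) (tilt th v) y.
rewrite /kit /= => ->; rewrite exprSr -mulrA ler_wpM2l ?exprn_ge0 //.
Qed.

End KilledChain.

(** * Exponential bounds *)

Section Bounds.
Variables (R : realType) (s0 : nat) (A : int -> int -> 'M[R]_s0).
Hypothesis A_ge0 : forall k l i j, 0 <= A k l i j.
Hypothesis irr : irreducible_chain A.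
Hypothesis irrP : irreducible_Pplus A.

(** Irreducibility in the quadrant gives a surviving path for each of the two unit moves at the
    origin; [pplus_shift] carries it to every point of the quadrant at no greater cost. *)
Lemma corridor (j : 'I_s0) : exists2 d, 0 < d <= 1 & forall (p q : nat) (x : int * int),
  0 <= x.1 -> 0 <= x.2 ->
  exists n, d ^+ (p + q) <= pplus A n (x, j) (x + (p%:Z, q%:Z), j).
Proof.
have [n1 h1] := @irrP ((0, 0), j) ((1, 0), j) isT isT.
have [n2 h2] := @irrP ((0, 0), j) ((0, 1), j) isT isT.
set d1 := pplus _ _ _ _ in h1; set d2 := pplus _ _ _ _ in h2.
(* The minimum with 1 makes powers of [d] nonincreasing, so an upper bound on the corridor length
   suffices later. *)
pose d := Num.min 1 (Num.min d1 d2).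
have d0 : 0 < d by rewrite !lt_min ltr01 h1.
exists d; first by rewrite d0 ge_min lexx.
have step (e : int * int) n (x : int * int) : d <= pplus A n ((0, 0), j) (e, j) ->
    0 <= x.1 -> 0 <= x.2 -> d <= pplus A n (x, j) (x + e, j).
  move=> hd x1 x2; apply: (le_trans hd).
  by have := pplus_shift A_ge0 n ((0, 0), j) (e, j) x1 x2; rewrite /translate /= addr0.
have comp k n m (x e f : int * int) : 0 <= x.1 + e.1 -> 0 <= x.2 + e.2 ->
    d ^+ k <= pplus A n (x, j) (x + e, j) -> d <= pplus A m (x + e, j) (x + e + f, j) ->
    exists n', d ^+ k.+1 <= pplus A n' (x, j) (x + e + f, j).
  move=> e1 e2 hn hm; exists (n + m)%N.
  have hy : inSplus (x + e, j) by rewrite /inSplus /= e1.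
  apply: le_trans (pplus_comp A_ge0 n m _ _ hy).
  by rewrite exprSr ler_pM // ?exprn_ge0 // ltW.
move=> p q x x1 x2; elim: q => [|q [n IH]].
  rewrite addn0; elim: p => [|p [n IH]].
    exists 0%N; rewrite expr0 /= addr0 eqxx /inSplus /= x1 x2.
    by rewrite lexx.
  have -> : x + (p.+1%:Z, 0%:Z) = x + (p%:Z, 0%:Z) + (1, 0).
    by case: x {x1 x2 IH} => a b; congr pair; rewrite /=; lia.
  apply: (comp _ n n1) => //=; [lia|lia|].
  apply: step; [by rewrite !ge_min lexx !orbT | rewrite /=; lia | rewrite /=; lia].
have -> : x + (p%:Z, q.+1%:Z) = x + (p%:Z, q%:Z) + (0, 1).
  by case: x {x1 x2 IH} => a b; congr pair; rewrite /=; lia.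
rewrite addnS; apply: (comp _ n n2) => //=; [lia|lia|].
apply: step; [by rewrite !ge_min lexx !orbT | rewrite /=; lia | rewrite /=; lia].
Qed.

Lemma square_le_expR (k : R) (m : nat) : 0 < k -> exists N0, forall N, (N0 <= N)%N ->
  2 * ((2 * (m * N)).+1 ^ 2)%:R <= expR (k * N%:R).
Proof.
move=> k0; pose a := (2 * m.+1)%:R : R.
have a0 : 0 <= a by exact: ler0n.
(* [2mN + 1 <= aN] for [N >= 1], and beyond this threshold the cubic term [(kN)^3/6] of the
   exponential exceeds [2 (aN)^2]. *)
exists (Num.truncn (12 * a ^+ 2 / k ^+ 3)).+1 => N hN.
have hN2 : 12 * a ^+ 2 / k ^+ 3 <= N%:R.
  apply/ltW/(@lt_le_trans _ _ (Num.truncn (12 * a ^+ 2 / k ^+ 3)).+1%:R).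
    exact: truncnS_gt.
  by rewrite ler_nat.
have N0 : 0 <= N%:R :> R by exact: ler0n.
have h := @expR_ge1Dxn R (k * N%:R) 2 (mulr_ge0 (ltW k0) N0).
apply: le_trans h; apply: (@le_trans _ _ (2 * (a * N%:R) ^+ 2)).
  rewrite ler_pM2l // natrX; apply: lerXn2r; rewrite ?nnegrE ?mulr_ge0 ?ler0n //.
  rewrite -natrM ler_nat; nia.
rewrite -[leLHS]add0r; apply: lerD => //.
have -> : (3`!)%:R = 6 :> R by [].
rewrite ler_pdivlMr //.
have -> : 2 * (a * N%:R) ^+ 2 * 6 = 12 * a ^+ 2 * N%:R ^+ 2 by ring.
have -> : (k * N%:R) ^+ 3 = N%:R * k ^+ 3 * N%:R ^+ 2 by ring.
by rewrite ler_wpM2r ?exprn_ge0 // -ler_pdivrMr ?exprn_gt0.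
Qed.

Variables (c1 c2 : nat).
Hypotheses (c1_gt0 : (0 < c1)%N) (c2_gt0 : (0 < c2)%N).
Variables (th0 : R * R) (s g : R).
Hypothesis G0 : Gamma A th0.
Hypothesis Gs : forall th, Gamma A th -> c1%:R * th.1 + c2%:R * th.2 <= s.
Hypothesis sg : s < g.

Lemma walk_translate m mu n (x v : int * int) :
  kit (walk_succs m) (walk_weight mu) n (dirac_at R v) 0 =
  kit (walk_succs m) (walk_weight mu) n (dirac_at R (x + v)) x.
Proof.
have := @kit_equivariant R _ (walk_succs m) (walk_weight mu) (+%R x) _ n (dirac_at R (x + v)) 0.
rewrite addr0 => <-; last by move=> F y; rewrite !walk_step; under [RHS]eq_bigr do rewrite -addrA.
congr (kit _ _ _ _ _); apply/funext => z; rewrite /dirac_at /comp.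
by congr (nat_of_bool _)%:R; apply/eqP/eqP => [->|/addrI].
Qed.

Lemma corner_ge0 (B : nat) (v : int * int) : v \in box B ->
  0 <= ((B%:Z, B%:Z) + v).1 /\ 0 <= ((B%:Z, B%:Z) + v).2.
Proof. by rewrite mem_box /= => h; split; lia. Qed.

Lemma corner_target (B a a' p q : nat) (v : int * int) :
  a%:Z = v.1 + p%:Z -> a'%:Z = v.2 + q%:Z ->
  ((B + a)%N%:Z, (B + a')%N%:Z) = (B%:Z, B%:Z) + v + (p%:Z, q%:Z).
Proof. by move=> h1 h2; congr pair; rewrite /=; lia. Qed.

(** [K] rounds up [N (lam + eps)] rather than [N lam], so [K c] overshoots [z]: the correction [p]
    is nonnegative, hence made of unit moves that stay in the quadrant, and up to a constant it is
    of order [N eps]. *)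
Lemma coordinate_bound (N K c : nat) (lam eps : R) (z : int) :
  0 < lam -> 0 < eps -> N%:R * lam + N%:R * eps <= K%:R ->
  K%:R <= N%:R * lam + N%:R * eps + 1 -> (0 < c)%N ->
  `|z%:~R - N%:R * (lam * c%:R)| <= N%:R * eps ->
  exists p : nat, (K * c)%:Z = z + p%:Z /\ p%:R <= c%:R + N%:R * eps * (c%:R + 1).
Proof.
move=> lam0 eps0 xK Kx c0; rewrite ler_norml => /andP[zl zu].
have cR : 1 <= c%:R :> R by rewrite ler1n.
have Nl0 : 0 <= N%:R * lam by rewrite mulr_ge0 // ltW.
have Ne0 : 0 <= N%:R * eps by rewrite mulr_ge0 // ltW.
have h1 : z%:~R <= (K * c)%:R :> R.
  apply: (@le_trans _ _ ((N%:R * lam + N%:R * eps) * c%:R)); last first.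
    by rewrite natrM ler_wpM2r // ler0n.
  by nra.
have [p hp] : exists p : nat, (K * c)%:Z = z + p%:Z.
  have h2 : z <= (K * c)%:Z by rewrite -(ler_int R).
  exists (absz ((K * c)%:Z - z)); lia.
exists p; split=> //.
have : (K * c)%:R = z%:~R + p%:R :> R.
  by rewrite -[p%:R]/(p%:Z%:~R) -rmorphD /= -hp.
rewrite natrM => e.
have : K%:R * c%:R <= (N%:R * lam + N%:R * eps + 1) * c%:R by rewrite ler_wpM2r // ler0n.
by nra.
Qed.

(** [N] loops reach one displacement [v] near [N lam c], then [p] moves right and [q] moves up
    complete it to exactly [K c]. The block starts at height [m N], where these loops cannot be
    killed, and the slack [eta = g - <c,th>] pays for all errors. *)
Lemma block_bound (j : 'I_s0) : exists K B n : nat, (0 < K)%N /\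
  expR (- (K%:R * g)) <=
    pplus A n ((B%:Z, B%:Z), j) (((B + K * c1)%N%:Z, (B + K * c2)%N%:Z), j).
Proof.
have c1R : 0 < c1%:R :> R by rewrite ltr0n.
have c2R : 0 < c2%:R :> R by rewrite ltr0n.
have [m [th [lam [m0 thg lam0 mgf1 [mean1 mean2]]]]] :=
  optimal_tilt A_ge0 irr j c1R c2R G0 Gs sg.
have [d /andP[d0 d1] hd] := corridor j.
pose L := - ln d; have L0 : 0 <= L by rewrite oppr_ge0 ln_le0.
have dE : d = expR (- L) by rewrite opprK lnK.
pose T := `|th.1| + `|th.2|; have T0 : 0 <= T by rewrite addr_ge0.
pose eta := g - (c1%:R * th.1 + c2%:R * th.2); have eta0 : 0 < eta by rewrite subr_gt0.
pose C := c1%:R + c2%:R + 2 : R.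
have C0 : 0 < C by rewrite /C; lra.
pose W := (T + L) * C + 1.
have TLC0 : 0 <= (T + L) * C by rewrite mulr_ge0 ?addr_ge0 // ltW.
have W0 : 0 < W by rewrite /W; lra.
(* The slack is [K eta >= 3 ka N]: one share pays the polynomial factor of the pigeonhole, two pay
   the correction, whose cost [(T + L)(p + q)] is at most [W + N eps W]. *)
pose ka := lam * eta / 3; have ka0 : 0 < ka by rewrite divr_gt0 // mulr_gt0.
pose eps := ka / W; have eps0 : 0 < eps by rewrite divr_gt0.
have [N1 hN1] := block_exists (loop_weight_ge0 A_ge0 j m) mgf1 mean1 mean2 eps0.
have [N2 hN2] := square_le_expR m ka0.
have [N [NN1 NN2 WN]] : exists N, [/\ (N1 <= N)%N, (N2 <= N)%N & W <= ka * N%:R].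
  exists (N1 + (N2 + (Num.truncn (W / ka)).+1))%N; split.
  - exact: leq_addr.
  - by rewrite addnCA leq_addr.
  rewrite mulrC -ler_pdivrMr //; apply/ltW/(@lt_le_trans _ _ (Num.truncn (W / ka)).+1%:R).
    exact: truncnS_gt.
  by rewrite ler_nat addnA leq_addl.
have [v [vbox v1 v2 hv]] := hN1 N NN1.
have hsz := hN2 N NN2.
rewrite size_box in hv.
have NR0 : 0 <= N%:R :> R by exact: ler0n.
pose x := N%:R * lam + N%:R * eps : R.
have x0 : 0 <= x by rewrite addr_ge0 // mulr_ge0 // ltW.
have [K [K0 xK Kx1]] : exists K : nat, [/\ (0 < K)%N, x <= K%:R & K%:R <= x + 1].
  have /andP[Kx xK] := truncn_itv x0.
  by exists (Num.truncn x).+1; split; rewrite // ?(ltW xK) // -natr1 lerD2r.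
have Ne0 : 0 <= N%:R * eps by rewrite mulr_ge0 // ltW.
have [p [pE pb]] := coordinate_bound lam0 eps0 xK Kx1 c1_gt0 v1.
have [q [qE qb]] := coordinate_bound lam0 eps0 xK Kx1 c2_gt0 v2.
pose b : int * int := ((m * N)%N%:Z, (m * N)%N%:Z).
have [bv1 bv2] : 0 <= (b + v).1 /\ 0 <= (b + v).2 by exact: corner_ge0.
have [n hn] := hd p q (b + v) bv1 bv2.
exists K, (m * N)%N, (m * N + n)%N; split => //.
rewrite (corner_target (m * N) pE qE) -/b.
have hy : inSplus (b + v, j) by rewrite /inSplus bv1.
apply: le_trans (pplus_comp A_ge0 _ n _ _ hy).
set U := kit _ _ _ _ _ in hv.
have U0 : 0 <= U.
  by apply: kit_ge0 => *; [exact: loop_weight_ge0 | exact: dirac_at_ge0].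
have hU : U <= pplus A (m * N) (b, j) (b + v, j).
  by rewrite /U (walk_translate _ _ _ b); apply: walk_le_pplus.
apply: (@le_trans _ _ (U * d ^+ (p + q))); last first.
  by apply: ler_pM => //; rewrite exprn_ge0 // ltW.
have hU2 : expR (- (dot th v + ka * N%:R)) <= U.
  rewrite expRN -[leLHS]mul1r ler_pdivrMr ?expR_gt0 // expRD mulrA.
  apply: (le_trans hv); rewrite ler_wpM2l //.
  by rewrite mulr_ge0 // ltW // ew_gt0.
apply: (@le_trans _ _ (expR (- (dot th v + ka * N%:R)) * d ^+ (p + q))); last first.
  by rewrite ler_wpM2r // exprn_ge0 // ltW.
rewrite dE -expRM_natl -expRD ler_expR natrD.
have vE1 : v.1%:~R = K%:R * c1%:R - p%:R :> R.
  apply/eqP; rewrite eq_sym subr_eq -natrM; apply/eqP.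
  by rewrite -[p%:R]/(p%:Z%:~R) -rmorphD /= -pE.
have vE2 : v.2%:~R = K%:R * c2%:R - q%:R :> R.
  apply/eqP; rewrite eq_sym subr_eq -natrM; apply/eqP.
  by rewrite -[q%:R]/(q%:Z%:~R) -rmorphD /= -qE.
have p0 : 0 <= p%:R :> R by exact: ler0n.
have q0 : 0 <= q%:R :> R by exact: ler0n.
have hdot : dot th v <= K%:R * (g - eta) + T * (p%:R + q%:R).
  have -> : K%:R * (g - eta) = K%:R * (c1%:R * th.1 + c2%:R * th.2) by rewrite /eta; ring.
  rewrite /dot vE1 vE2.
  have t1 : - th.1 <= T by rewrite (le_trans (ler_norm _)) // normrN lerDl.
  have t2 : - th.2 <= T by rewrite (le_trans (ler_norm _)) // normrN lerDr.
  by have := ler_wpM2r p0 t1; have := ler_wpM2r q0 t2; lra.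
have hK : 3 * (ka * N%:R) <= K%:R * eta.
  have -> : 3 * (ka * N%:R) = N%:R * lam * eta by rewrite /ka; field.
  rewrite ler_pM2r //; by apply: le_trans xK; rewrite lerDl.
have hpq : (T + L) * (p%:R + q%:R) <= 2 * (ka * N%:R).
  apply: (@le_trans _ _ ((T + L) * (C + N%:R * eps * C))).
    by rewrite ler_wpM2l ?addr_ge0 //; move: pb qb; rewrite /C; lra.
  have -> : (T + L) * (C + N%:R * eps * C) = (T + L) * C + N%:R * eps * ((T + L) * C) by ring.
  have e1 : N%:R * eps * ((T + L) * C) <= N%:R * eps * W by rewrite ler_wpM2l // /W lerDl.
  have e2 : N%:R * eps * W = ka * N%:R by rewrite /eps; field; exact: lt0r_neq0.
  have e3 : (T + L) * C <= W by rewrite /W lerDl.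
  by move: WN e1 e2 e3; lra.
by move: hdot hK hpq; lra.
Qed.

(** The truncated subtraction is exact, because [c >= 1] gives [B <= c (B + r) + l]. *)
Lemma corridor_coord (c B b K r l : nat) : (0 < c)%N ->
  (c * (B + b * K + r) + l)%N%:Z = (B + b * K * c)%N%:Z + (c * (B + r) + l - B)%N%:Z.
Proof.
move=> c0; have h : (B <= c * (B + r) + l)%N.
  by rewrite -[leqLHS]mul1n; apply: leq_trans (leq_addr _ _); apply: leq_mul; rewrite ?leq_addr.
rewrite -PoszD [in RHS]addnAC subnKC //; congr Posz.
ring.
Qed.

Lemma corridor_length (c B r K l : nat) : (r < K)%N ->
  (c * (B + r) + l - B <= c * (B + K) + l)%N.
Proof.
move=> rK; apply: (leq_trans (leq_subr _ _)).
by rewrite leq_add2r leq_mul2l leq_add2l (ltnW rK) orbT.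
Qed.

(** Go from the start to the corner [(B,B)], repeat the block [b] times, correct by a corridor, and
    change phase from [j] to [j']. Only the number of blocks grows with [k]; the rest costs a
    constant factor. *)
Lemma lower_bound (j j' : 'I_s0) (x1 x2 l1 l2 : nat) : exists C k0, 0 < C /\
  forall k : nat, (k0 <= k)%N -> exists n, C * expR (- (k%:R * g)) <=
    pplus A n ((x1%:Z, x2%:Z), j) (((c1 * k + l1)%N%:Z, (c2 * k + l2)%N%:Z), j').
Proof.
have [K [B [n [K0 hblock]]]] := block_bound j.
have [d /andP[d0 d1] hd] := corridor j.
have [n0 a0] := @irrP ((x1%:Z, x2%:Z), j) ((B%:Z, B%:Z), j) isT isT.
have [n3 a3] := @irrP ((0, 0), j) ((0, 0), j') isT isT.
set e0 := pplus _ _ _ _ in a0; set e3 := pplus _ _ _ _ in a3.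
pose D := (c1 * (B + K) + l1 + (c2 * (B + K) + l2))%N.
pose y b : int * int := ((B + b * K * c1)%N%:Z, (B + b * K * c2)%N%:Z).
(* Each block ends at the corner translated by a nonnegative vector, so [pplus_shift] allows the
   next repetition. *)
have iter_block b : exists n', expR (- (b * K)%:R * g) <= pplus A n' (y 0%N, j) (y b, j).
  elim: b => [|b [n' IH]].
    by exists 0%N; rewrite mul0n oppr0 mul0r expR0 /= eqxx.
  exists (n' + n)%N; have hy : inSplus (y b, j) by [].
  apply: le_trans (pplus_comp A_ge0 n' n _ _ hy).
  rewrite mulSn natrD opprD mulrDl addrC expRD.
  apply: ler_pM; rewrite ?expR_ge0 //; rewrite mulNr; apply: (le_trans hblock).
  have := @pplus_shift _ _ _ A_ge0 n ((b * K * c1)%N%:Z, (b * K * c2)%N%:Z)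
     ((B%:Z, B%:Z), j) (((B + K * c1)%N%:Z, (B + K * c2)%N%:Z), j) isT isT.
  rewrite /translate /=; congr (_ <= pplus _ _ (_, _) (_, _)).
    by congr pair; rewrite /=; lia.
  by congr pair; rewrite /=; lia.
(* [D] bounds the total corridor length for every remainder [r < K]; the factor with [|g|] pays for
   the at most [B + K] units of [k] not covered by blocks, whatever the sign of [g]. *)
exists (e0 * e3 * d ^+ D * expR (- ((B + K)%:R * `|g|))), B; split.
  by rewrite !mulr_gt0 ?expR_gt0 ?exprn_gt0.
(* Dividing [k - B] rather than [k] keeps the target beyond the last block, so the corridor goes
   only right and up. *)
move=> k Bk; pose b := ((k - B) %/ K)%N; pose r := ((k - B) %% K)%N.
have kE : k = (B + b * K + r)%N by rewrite -addnA -divn_eq subnKC.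
have rK : (r < K)%N by rewrite ltn_mod.
have [n1 h1] := iter_block b.
pose p := (c1 * (B + r) + l1 - B)%N; pose q := (c2 * (B + r) + l2 - B)%N.
have [||n2 h2] := hd p q (y b); [by []|by []|].
pose z : int * int := ((c1 * k + l1)%N%:Z, (c2 * k + l2)%N%:Z).
have zE : y b + (p%:Z, q%:Z) = z.
  by rewrite /z kE; congr pair; rewrite /= corridor_coord.
rewrite zE in h2.
have h3 : e3 <= pplus A n3 (z, j) (z, j').
  have := @pplus_shift _ _ _ A_ge0 n3 z ((0, 0), j) ((0, 0), j') isT isT.
  by rewrite /translate /= addr0.
have h0 : e0 <= pplus A n0 ((x1%:Z, x2%:Z), j) (y 0%N, j).
  by rewrite /e0 /y !mul0n addn0.
exists (n0 + n1 + n2 + n3)%N.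
have hz : inSplus (z, j) by [].
have hyb : inSplus (y b, j) by [].
have hy0 : inSplus (y 0%N, j) by [].
apply: le_trans (pplus_comp A_ge0 _ n3 _ _ hz).
apply: (@le_trans _ _ (e0 * expR (- (b * K)%:R * g) * d ^+ (p + q) * e3)); last first.
  rewrite ler_pM //; first by rewrite !mulr_ge0 ?expR_ge0 ?exprn_ge0 // ltW.
    exact: ltW.
  apply: le_trans (pplus_comp A_ge0 _ n2 _ _ hyb).
  rewrite ler_pM //; first by rewrite !mulr_ge0 ?expR_ge0 // ltW.
    by rewrite exprn_ge0 // ltW.
  apply: le_trans (pplus_comp A_ge0 _ n1 _ _ hy0).
  by rewrite ler_pM ?expR_ge0 // ltW.
have -> : e0 * e3 * d ^+ D * expR (- ((B + K)%:R * `|g|)) * expR (- (k%:R * g)) =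
  e0 * e3 * (d ^+ D * (expR (- ((B + K)%:R * `|g|)) * expR (- (k%:R * g)))) by ring.
have -> : e0 * expR (- (b * K)%:R * g) * d ^+ (p + q) * e3 =
  e0 * e3 * (d ^+ (p + q) * expR (- (b * K)%:R * g)) by ring.
rewrite ler_pM2l ?mulr_gt0 //; apply: ler_pM.
- by rewrite exprn_ge0 // ltW.
- by rewrite mulr_ge0 ?expR_ge0.
- by rewrite ler_wiXn2l ?(ltW d0) // /D leq_add // corridor_length.
rewrite -expRD ler_expR.
have -> : k%:R = (B + r)%:R + (b * K)%:R :> R by rewrite -natrD [in LHS]kE addnAC.
have hBr : (B + r)%:R <= (B + K)%:R :> R by rewrite ler_nat leq_add2l ltnW.
have : - ((B + r)%:R * g) <= (B + K)%:R * `|g|.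
  rewrite -mulrN; apply: (@le_trans _ _ ((B + r)%:R * `|g|)).
    by rewrite ler_wpM2l ?ler0n // -normrN ler_norm.
  by rewrite ler_wpM2r.
by lra.
Qed.

(** Summing the contraction over time gives a geometric series, and dividing by the tilt at the
    target produces the decay in [k]. *)
Lemma upper_bound th (j j' : 'I_s0) (x1 x2 l1 l2 : nat) : Gamma A th ->
  exists2 C, 0 < C & forall k : nat,
  (qtilde A ((x1%:Z, x2%:Z), j) (((c1 * k + l1)%N%:Z, (c2 * k + l2)%N%:Z), j')
   <= (C * expR (- (k%:R * (c1%:R * th.1 + c2%:R * th.2))))%:E)%E.
Proof.
move=> /(Gamma_contraction A_ge0)[v [r [v0 r0 r1 hK]]].
set y := ((x1%:Z, x2%:Z), j).
have h0 z : 0 < tilt th v z by rewrite mulr_gt0 ?ew_gt0.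
exists (tilt th v y / (1 - r) / (ew th (l1%:Z, l2%:Z) * v j')).
  by rewrite !divr_gt0 ?subr_gt0 // mulr_gt0 ?ew_gt0.
move=> k; set y' := (_, j').
have -> : tilt th v y / (1 - r) / (ew th (l1%:Z, l2%:Z) * v j') *
    expR (- (k%:R * (c1%:R * th.1 + c2%:R * th.2))) = tilt th v y / (1 - r) / tilt th v y'.
  have -> : tilt th v y' = expR (k%:R * (c1%:R * th.1 + c2%:R * th.2)) *
      (ew th (l1%:Z, l2%:Z) * v j').
    rewrite /tilt mulrA; congr (_ * _); rewrite /ew -expRD; congr expR.
    by rewrite /dot /= -!pmulrn !natrD !natrM; ring.
  set w := ew th (l1%:Z, l2%:Z) * v j'.
  by rewrite expRN [X in _ = _ * X]invfM [RHS]mulrA mulrAC.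
apply: lime_le; first by apply: is_cvg_nneseries => n _ _; rewrite lee_fin pplus_ge0.
apply: nearW => N; rewrite sumEFin lee_fin.
rewrite ler_pdivlMr // ler_pdivlMr ?subr_gt0 //.
apply: (@le_trans _ _ ((1 - r ^+ N) * tilt th v y)); last first.
  by rewrite ger_pMl // lerBlDr lerDl exprn_ge0 // ltW.
elim: N => [|N IH].
  by rewrite big_geq // expr0 subrr !mul0r.
rewrite big_nat_recr //= !mulrDl.
have := pplus_contraction A_ge0 N y y' (ltW r0) v0 hK.
have r1' : 0 <= 1 - r by rewrite subr_ge0 ltW.
move=> /(ler_wpM2r r1'); rewrite exprS; nra.
Qed.

End Bounds.

(** * The logarithmic rate *)

(** On [Gamma] every [phi] is at most 1, so [phi_gt1_far] confines [Gamma] to a square. *)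
Lemma Gamma_bounded (R : realType) (s0 : nat) (A : int -> int -> 'M[R]_s0)
  (j : 'I_s0) (c1 c2 : nat) :
  (forall k l i j, 0 <= A k l i j) -> irreducible_chain A ->
  exists s, forall th, Gamma A th -> c1%:R * th.1 + c2%:R * th.2 <= s.
Proof.
move=> A_ge0 irr; have [n [B hB]] := phi_gt1_far A_ge0 irr j.
exists (c1%:R * B + c2%:R * B) => th Gth.
have [r /andP[r0 r1] hr] := phi_le_geometric A_ge0 Gth.
have [|b1 b2] := hB n th (leqnn n).
  by apply: (le_trans (hr j _)); rewrite exprn_ile1 // ltW.
by apply: lerD; rewrite ler_wpM2l ?ler0n // (le_trans (ler_norm _)).
Qed.

Section LogRate.
Import numFieldNormedType.Exports.

(** The constants contribute only [ln C / k], which vanishes, and the two exponents bracket [-S]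
    within [e/2]. *)
Lemma log_rate_cvg (R : realType) (q : nat -> \bar R) (S : R) :
  (forall e, 0 < e -> exists2 C, 0 < C &
     \forall k \near \oo, ((C * expR (- (k%:R * (S + e))))%:E <= q k)%E) ->
  (forall e, 0 < e -> exists2 C, 0 < C &
     \forall k \near \oo, (q k <= (C * expR (- (k%:R * (S - e))))%:E)%E) ->
  ((fun k : nat => ((k%:R)^-1)%:E * elog (q k))%E @ \oo --> (- S%:E)%E).
Proof.
move=> hlo hup.
pose u (k : nat) : R := k%:R^-1 * ln (fine (q k)).
have e4 (e : R) : 0 < e -> 0 < e / 2 by move=> ?; rewrite divr_gt0.
have small (C e : R) : 0 < e -> \forall k \near \oo, `|k%:R^-1 * ln C| < e.
  move=> e0; have : (fun k : nat => k%:R^-1 * ln C) @ \oo --> (0 * ln C).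
    apply: cvgM; last exact: cvg_cst.
    have /cvgrPdist_lt h := @cvg_harmonic R.
    apply/cvgrPdist_lt => d d0; have [N _ hN] := h d d0.
    (* [cvg_harmonic] concerns [1/(k+1)], hence the shift to [N.+1]. *)
    exists N.+1 => // -[//|k] /= Nk; exact: hN.
  rewrite mul0r => /cvgrPdist_lt/(_ e e0); apply: filterS => k.
  by rewrite sub0r normrN.
have [Cl Cl0 lo1] := hlo 1 ltr01; have [Cu Cu0 up1] := hup 1 ltr01.
(* By the bounds with [e = 1], eventually [q k] is finite and positive, so [elog] is an ordinary
   logarithm. *)
have qE : \forall k \near \oo, (((k%:R)^-1)%:E * elog (q k))%E = (u k)%:E.
  near=> k.
  have h1 : ((Cl * expR (- (k%:R * (S + 1))))%:E <= q k)%E by near: k.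
  have h2 : (q k <= (Cu * expR (- (k%:R * (S - 1))))%:E)%E by near: k.
  rewrite /u; case: (q k) h1 h2 => [x||] //=.
  rewrite !lee_fin => h1 _; rewrite leNgt (lt_le_trans _ h1) //.
  by rewrite mulr_gt0 ?expR_gt0.
apply: (@cvg_trans _ ((fun k => (u k)%:E) @ \oo)).
  apply: near_eq_cvg; near=> k; apply/esym; near: k; exact: qE.
rewrite -EFinN; apply: cvg_EFin; first by apply: nearW.
apply/cvgrPdist_lt => e e0.
have [C1 C10 lo] := hlo _ (e4 _ e0); have [C2 C20 up] := hup _ (e4 _ e0).
near=> k.
have k0 : 0 < k%:R :> R by rewrite ltr0n; near: k; exists 1%N.
have h1 : ((C1 * expR (- (k%:R * (S + e / 2))))%:E <= q k)%E by near: k.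
have h2 : (q k <= (C2 * expR (- (k%:R * (S - e / 2))))%:E)%E by near: k.
have s1 : `|k%:R^-1 * ln C1| < e / 2 by near: k; apply: small; exact: e4.
have s2 : `|k%:R^-1 * ln C2| < e / 2 by near: k; apply: small; exact: e4.
rewrite /comp /u; case: (q k) h1 h2 => [x||] //=.
rewrite !lee_fin => h1 h2.
have p1 : 0 < C1 * expR (- (k%:R * (S + e / 2))) by rewrite mulr_gt0 ?expR_gt0.
have x0 : 0 < x := lt_le_trans p1 h1.
have p2 := lt_le_trans x0 h2.
move: h1 h2; rewrite -ler_ln ?posrE // -[x <= _]ler_ln ?posrE //.
rewrite !lnM ?posrE ?expR_gt0 // !expRK => h1 h2.
have kV : 0 <= k%:R^-1 :> R by rewrite invr_ge0 ltW.
have kE (y : R) : k%:R^-1 * - (k%:R * y) = - y.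
  by rewrite mulrN mulrA mulVf ?mul1r // gt_eqF.
have := ler_wpM2l kV h1; rewrite mulrDr kE => {}h1.
have := ler_wpM2l kV h2; rewrite mulrDr kE => {}h2.
move: s1 s2; rewrite !ltr_norml => /andP[s1 _] /andP[_ s2].
by apply/andP; split; lra.
Unshelve. all: by end_near.
Qed.

End LogRate.

Unset Implicit Arguments.

Theorem theorem5p1 (R : realType) (s0 : nat) (A : int -> int -> 'M[R]_s0)
  (pi : 'rV[R]_s0)
  (hs0 : (0 < s0)%N)
  (hA_nonneg : forall k l i j, 0 <= A k l i j)
  (hA_stoch : forall i, \sum_(j < s0) Asum A i j = 1)
  (hpi_nonneg : forall j, 0 <= pi 0 j)
  (hpi_sum : \sum_(j < s0) pi 0 j = 1)
  (hpi_stat : pi *m Asum A = pi)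
  (hirr : irreducible_chain A)
  (haper : aperiodic_chain A)
  (hdrift : drift1 A pi < 0 \/ drift2 A pi < 0)
  (hirrplus : irreducible_Pplus A)
  (c1 c2 : nat) (hc1 : (0 < c1)%N) (hc2 : (0 < c2)%N)
  (x1 x2 : nat) (hx : x1 = 0%N \/ x2 = 0%N)
  (l1 l2 : nat) (hl : l1 = 0%N \/ l2 = 0%N)
  (j j' : 'I_s0) :
  ((fun k : nat =>
      ((k%:R)^-1)%:E *
      elog (qtilde A ((x1%:Z, x2%:Z), j)
                     (((c1 * k + l1)%N%:Z, (c2 * k + l2)%N%:Z), j')))%E
     @ \oo -->
   (- ereal_sup [set ((c1%:R * th.1 + c2%:R * th.2)%:E : \bar R)
                | th in Gamma A])%E).
Proof.
have [th0 G0] := Gamma_nonempty hA_nonneg hA_stoch hirr hpi_sum hpi_stat hdrift.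
have [s hs] := Gamma_bounded j c1 c2 hA_nonneg hirr.
pose f (th : R * R) : R := c1%:R * th.1 + c2%:R * th.2.
pose E := f @` Gamma A; pose S := sup E.
have E0 : E !=set0 by exists (f th0), th0.
have Eub : has_ubound E by exists s => _ [th hth <-]; exact: hs.
have -> : [set ((c1%:R * th.1 + c2%:R * th.2)%:E : \bar R) | th in Gamma A] =
    EFin @` E by rewrite -image_comp.
(* [Gamma] is nonempty and the form is bounded above on it, so the extended supremum is the real
   number [S]. *)
rewrite ereal_sup_EFin // -/S.
have hS th : Gamma A th -> c1%:R * th.1 + c2%:R * th.2 <= S.
  by move=> hth; apply: ub_le_sup => //; exists th.
apply: log_rate_cvg => e e0.
  have Se : S < S + e by rewrite ltrDl.
  have [C [k0 [C0 hC]]] := lower_bound hA_nonneg hirr hirrplus hc1 hc2 G0 hS Se j j' x1 x2 l1 l2.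
  exists C => //; exists k0 => // k /= /hC[n hn].
  by apply: le_trans (qtilde_ge hA_nonneg n _ _); rewrite lee_fin.
(* For the upper estimate, take [th] in [Gamma] with linear form above [S - e]. *)
have [_ [th Gth <-] Sth] := sup_adherent e0 (conj E0 Eub).
have [C C0 hC] := upper_bound hA_nonneg c1 c2 j j' x1 x2 l1 l2 Gth.
exists C => //; apply: nearW => k; apply: (le_trans (hC k)).
by rewrite lee_fin ler_pM2l // ler_expR lerN2 ler_wpM2l // ltW.
Qed.
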